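(* Let $\mathbf{m},\mathbf{d}\in\mathbb{N}^k$, $\omega\ge1$, $V=\bigotimes_{i=1}^k\mathrm{Sym}^{d_i}\mathbb{C}^{m_i+1}$ with its Bombieri-Weyl quadratic form $q_{\mathrm{BW}}$, and $X=\nu_{\mathbf d}(\mathbb{P}^{\mathbf m})\subseteq\mathbb{P}(V)$. Consider the projection $\pi\colon\mathrm{Sym}^\omega V\to\bigotimes_{i=1}^k\mathrm{Sym}^{\omega d_i}\mathbb{C}^{m_i+1}$. For any $f\in\mathrm{Sym}^\omega V$, the locus of normalized $X$-eigenvectors of $f$ coincides with the locus of normalized singular tuples of $\pi(f)\in\bigotimes_{i=1}^k\mathrm{Sym}^{\omega d_i}\mathbb{C}^{m_i+1}=\mathbb{C}[x]_{\omega\mathbf d}$; that is, $\psi\in V$ is a normalized $X$-eigenvector of $f$ if and only if $\psi=\pm\, v_1^{d_1}\otimes\cdots\otimes v_k^{d_k}$ for some normalized singular $k$-tuple $(v_1,\ldots,v_k)$ of $\pi(f)$.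
   Context: The components of $\mathbf m=(m_1,\ldots,m_k)$ and $\mathbf d=(d_1,\ldots,d_k)$ are positive integers. $\mathbb{P}^{\mathbf m}=\prod_{i=1}^k\mathbb{P}^{m_i}$ (complex), and $\nu_{\mathbf d}([v_1],\ldots,[v_k])=[v_1^{d_1}\otimes\cdots\otimes v_k^{d_k}]$ is the Segre-Veronese embedding. For $\mathbf e\in\mathbb{N}^k$, $\mathbb{C}[x]_{\mathbf e}$ is the space of $k$-homogeneous polynomials of multidegree $\mathbf e$ in the groups of variables $x_i=(x_{i,0},\ldots,x_{i,m_i})$; it is identified with $\bigotimes_i\mathrm{Sym}^{e_i}\mathbb{C}^{m_i+1}$, with $v_1^{e_1}\otimes\cdots\otimes v_k^{e_k}$ corresponding to $\prod_i(v_{i,0}x_{i,0}+\cdots+v_{i,m_i}x_{i,m_i})^{e_i}$. Its Bombieri-Weyl bilinear form is the complex-bilinear form for which the polynomials $\prod_{i=1}^k\binom{e_i}{\alpha_i}^{1/2}x_i^{\alpha_i}$ ($\alpha_i\in\mathbb{Z}_{\ge0}^{m_i+1}$, $|\alpha_i|=e_i$) are an orthonormal basis; taking $\mathbf e=\mathbf d$ gives the form $\langle\,,\rangle_{\mathrm{BW}}$ and $q_{\mathrm{BW}}$ on $V$. $\mathrm{Sym}^\omega V$ is identified with homogeneous polynomials of degree $\omega$ on $V$, where the power $\psi^\omega$ corresponds to the polynomial $v\mapsto\langle\psi,v\rangle_{\mathrm{BW}}^\omega$; it carries the Bombieri-Weyl form determined by $\langle\psi^\omega,\varphi^\omega\rangle=\langle\psi,\varphi\rangle_{\mathrm{BW}}^\omega$.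 The linear span of $\{\psi^\omega:\psi\in C(X)\}$ in $\mathrm{Sym}^\omega V$ is identified with $\bigotimes_i\mathrm{Sym}^{\omega d_i}\mathbb{C}^{m_i+1}$ by $(v_1^{d_1}\otimes\cdots\otimes v_k^{d_k})^\omega\leftrightarrow v_1^{\omega d_1}\otimes\cdots\otimes v_k^{\omega d_k}$, and $\pi$ is the orthogonal projection onto it. A normalized $X$-eigenvector of $f$ is a nonsingular point $\psi$ of $C(X)\cap\{q_{\mathrm{BW}}=1\}\subseteq V$ at which the differential of the restriction of $f$ vanishes on the tangent space, where $C(X)\subseteq V$ is the affine cone over $X$. A normalized singular $k$-tuple of $g\in\mathbb{C}[x]_{\mathbf e}$ is a tuple $(v_1,\ldots,v_k)$, $v_i\in\mathbb{C}^{m_i+1}$, with $\sum_jv_{i,j}^2=1$ and $\frac{1}{e_i}\nabla_ig(v_1,\ldots,v_k)=\sigma v_i$ for all $i\in\{1,\ldots,k\}$, for some common $\sigma\in\mathbb{C}$, where $\nabla_i$ is the gradient with respect to $x_i$. *)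

(* Defs.v *)
From mathcomp Require Import all_boot all_order all_algebra.
From mathcomp Require Import classical_sets.
From mathcomp Require Import mpoly.

Set Implicit Arguments.
Unset Strict Implicit.
Unset Printing Implicit Defensive.

Import Order.TTheory GRing.Theory Num.Theory.
Local Open Scope ring_scope.
Local Open Scope classical_set_scope.

(* A closed subset of C^n carries its reduced structure: tangent spaces are   *)
(* cut out by all the polynomials that vanish on it.                          *)
Section AffineGeometry.
Variables (C : fieldType) (n : nat).
Implicit Types (Y Z : set 'rV[C]_n) (P : {mpoly C[n]}) (y w : 'rV[C]_n).

Definition zero_locus (E : set {mpoly C[n]}) : set 'rV[C]_n :=
  [set y | forall P, E P -> P.@[y 0] = 0].

Definition vanishing_ideal Y : set {mpoly C[n]} :=
  [set P | forall y, Y y -> P.@[y 0] = 0].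

Definition zariski_closed Z := exists E, Z = zero_locus E.

Definition irreducible_closed Z :=
  [/\ zariski_closed Z, Z !=set0 &
      forall Z1 Z2, zariski_closed Z1 -> zariski_closed Z2 ->
        Z `<=` Z1 `|` Z2 -> Z `<=` Z1 \/ Z `<=` Z2].

Definition irreducible_chain Y y (r : nat) :=
  exists Z : nat -> set 'rV[C]_n,
    (forall i, (i <= r)%N -> [/\ irreducible_closed (Z i), Z i y & Z i `<=` Y]) /\
    (forall i, (i < r)%N -> Z i `<` Z i.+1).

(* The Krull dimension of the local ring of Y at y. *)
Definition local_dim Y y (r : nat) :=
  irreducible_chain Y y r /\
  forall s, irreducible_chain Y y s -> (s <= r)%N.

Definition differential P y w : C := \sum_(l < n) P^`M(l).@[y 0] * w 0 l.

Definition tangent_space Y y : set 'rV[C]_n :=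
  [set w | forall P, vanishing_ideal Y P -> differential P y w = 0].

Definition tangent_dim Y y (r : nat) :=
  exists U : {vspace 'rV[C]_n},
    (forall w, w \in U <-> tangent_space Y y w) /\ \dim U = r.

Definition nonsingular Y y :=
  Y y /\ exists r, local_dim Y y r /\ tangent_dim Y y r.

End AffineGeometry.

(* Bombieri-Weyl form on polynomials in n variables.  The monomial x^a has    *)
(* square norm a! / E; on multidegree (e_1, ..., e_k), for E = \prod_i e_i!,  *)
(* this is the inverse of the product of the multinomials binom(e_i, a_i).    *)
Definition bw_form (C : fieldType) (n E : nat) (p q : {mpoly C[n]}) : C :=
  \sum_(a <- msupp p) p@_a * q@_a * ((\prod_(l < n) (a l)`!)%N%:R / E%:R).

Section SegreVeronese.
Variables (C : numClosedFieldType) (k : nat) (m : 'I_k -> nat).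

(* The variables x_{i,j}, 0 <= j <= m_i, numbered through the enumeration of  *)
(* the pairs (i, j).                                                          *)
Definition var := {i : 'I_k & 'I_(m i).+1}.
Definition nvars := #|{: var}|.
Definition vnum (i : 'I_k) (j : 'I_(m i).+1) : 'I_nvars :=
  enum_rank (Tagged (fun i => 'I_(m i).+1) j : var).

Definition vectors := forall i : 'I_k, 'rV[C]_(m i).+1.

Definition coords (v : vectors) (l : 'I_nvars) : C :=
  v (tag (enum_val l)) 0 (tagged (enum_val l)).

Definition multideg (a : 'X_{1..nvars}) (i : 'I_k) : nat :=
  \sum_(j < (m i).+1) a (vnum j).

(* C[x]_e, which is also the tensor product of the Sym^{e_i} C^{m_i + 1} *)
Definition multihomog (e : 'I_k -> nat) : pred {mpoly C[nvars]} :=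
  fun g => all (fun a => [forall i, multideg a i == e i]) (msupp g).

(* v_1^{e_1} \otimes ... \otimes v_k^{e_k} *)
Definition tensor_pow (e : 'I_k -> nat) (v : vectors) : {mpoly C[nvars]} :=
  \prod_(i < k) (\sum_(j < (m i).+1) v i 0 j *: 'X_(vnum j)) ^+ e i.

Definition bw (e : 'I_k -> nat) : {mpoly C[nvars]} -> {mpoly C[nvars]} -> C :=
  bw_form (\prod_(i < k) (e i)`!)%N.

Definition gradient (i : 'I_k) (g : {mpoly C[nvars]}) (v : vectors) :
    'rV[C]_(m i).+1 :=
  \row_j (g^`M(vnum j)).@[coords v].

Definition singular_tuple (e : 'I_k -> nat) (g : {mpoly C[nvars]})
    (v : vectors) :=
  (forall i, \sum_(j < (m i).+1) v i 0 j ^+ 2 = 1) /\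
  exists sigma : C, forall i, (e i)%:R^-1 *: gradient i g v = sigma *: v i.

(* V is C[x]_d; its orthonormal basis of rescaled monomials makes it C^dimV. *)
Variable d : 'I_k -> nat.

Definition exponents : {set 'X_{1..nvars < (\sum_(i < k) d i).+1}} :=
  [set a : 'X_{1..nvars < (\sum_(i < k) d i).+1} | [forall i, multideg a i == d i]]%SET.
Definition dimV := #|exponents|.
Definition exponent (l : 'I_dimV) : 'X_{1..nvars} := val (enum_val l).

(* \prod_i binom(d_i, a_i) *)
Definition multibinom (a : 'X_{1..nvars}) : C :=
  (\prod_(i < k) (d i)`!)%N%:R / (\prod_(l < nvars) (a l)`!)%N%:R.

Definition bw_basis (l : 'I_dimV) : {mpoly C[nvars]} :=
  sqrtC (multibinom (exponent l)) *: 'X_[exponent l].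

Definition toV (y : 'rV[C]_dimV) : {mpoly C[nvars]} :=
  \sum_(l < dimV) y 0 l *: bw_basis l.

(* The affine cone C(X). *)
Definition cone (psi : {mpoly C[nvars]}) :=
  exists (c : C) (v : vectors),
    (forall i, v i != 0) /\ psi = c *: tensor_pow d v.

(* C(X) \cap {q_BW = 1}, in coordinates. *)
Definition unit_cone : set 'rV[C]_dimV :=
  [set y | cone (toV y) /\ bw d (toV y) (toV y) = 1].

(* Homogeneous polynomials of degree omega on V are elements of               *)
(* {mpoly C[dimV]} in the coordinates above.                                  *)
Definition eigenvector (f : {mpoly C[dimV]}) (psi : {mpoly C[nvars]}) :=
  exists y : 'rV[C]_dimV,
    [/\ psi = toV y, nonsingular unit_cone y &
        forall w, tangent_space unit_cone y w -> differential f y w = 0].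

(* psi^omega, i.e. the polynomial v |-> <psi, v>^omega. *)
Definition sym_pow (omega : nat) (psi : {mpoly C[nvars]}) : {mpoly C[dimV]} :=
  (\sum_(l < dimV) bw d psi (bw_basis l) *: 'X_l) ^+ omega.

(* h is the orthogonal projection of f onto the span of the psi^omega, psi in *)
(* the cone (f - h is orthogonal to that span), and g is its image in         *)
(* C[x]_{omega d} under (v_1^{d_1} \otimes ...)^omega |->                     *)
(* v_1^{omega d_1} \otimes ... .                                              *)
Definition is_proj (omega : nat) (f : {mpoly C[dimV]}) (g : {mpoly C[nvars]}) :=
  exists (r : nat) (c : 'I_r -> C) (v : 'I_r -> vectors),
    let h := \sum_(s < r) c s *: sym_pow omega (tensor_pow d (v s)) in
    (forall phi, cone phi -> bw_form omega`! (f - h) (sym_pow omega phi) = 0) /\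
    g = \sum_(s < r) c s *: tensor_pow (fun i => omega * d i)%N (v s).

(* There is exactly one such g when omega and the d_i are positive and f is   *)
(* homogeneous of degree omega, so the default value 0 is then irrelevant.    *)
Definition proj (omega : nat) (f : {mpoly C[dimV]}) : {mpoly C[nvars]} :=
  xget 0 [set g | is_proj omega f g].

End SegreVeronese.

(* Main.v *)
Require Import Defs.
From mathcomp Require Import all_boot all_order all_algebra.
From mathcomp Require Import boolp classical_sets reals complex mpoly.
From mathcomp Require Import ring zify.

Set Implicit Arguments.
Unset Strict Implicit.
Unset Printing Implicit Defensive.

(** Let [veronese u] be the vector of orthonormal coordinates of
    [tensor_pow d u].  Its entries are rescaled monomials in [u], and
    [<veronese u, veronese p> = prod_i (u_i . p_i)^(d_i)].

    A homogeneous form takes at a point the value of its Bombieri-Weyl product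
    with the corresponding power of a linear form.  Projecting [f] orthogonally
    onto the span of the powers of points of the cone therefore keeps exactly the
    values of [f] on the cone: [g = proj omega f] is the form with
    [g(u) = f(veronese u)] for all [u] (lemma [proj_meval]).  The projection
    exists because the products of powers of linear forms span all multihomogeneous
    forms: a form orthogonal to all of them vanishes at every point.

    The unit part of the cone consists of the points [eps *: veronese u] with
    [eps^2 = 1] and [u_i . u_i = 1] for all [i] ([unit_coneP]).  Its tangent space
    there is the image, under the differential of [veronese], of the vectors [z]
    with [u_i . z_i = 0] for all [i] ([tangent_sub], [tangent_sup]).  Hence the
    differential of [f] vanishes on it iff each partial gradient of [g] at [u] is
    orthogonal to everything orthogonal to [u_i], that is, iff it is a multiple of
    [u_i].  Euler's identity [grad_i g(u) . u_i = omega d_i g(u)] then identifies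
    the multiple as [omega d_i g(u)], so that [sigma = g(u)] serves all [i] at once
    ([critical_gradient]).

    It remains to see that every point of the unit cone is nonsingular.  The
    tangent space has dimension [M], the sum of the [m_i]
    ([unit_cone_tangent_dim]), so the local dimension has to be [M] as well.
    - A chain of length [M]: stereographic projection parametrizes a neighbourhood
      of the point by an affine space of dimension [M]; the closures of the images
      of a flag of coordinate subspaces are irreducible and increase strictly
      ([unit_cone_chain]).
    - No longer chain ([unit_cone_chain_bound]): polynomials separating the
      successive members of a chain of length [s] are algebraically independent on
      its last member, which gives [r^s] independent functions of degree [O(r)].
      But a polynomial of degree [K] on the unit cone pulls back to the product of
      spheres, where [x_0^2] can be eliminated from each group of variables, so that
      it is a combination of only [O(K^M)] monomials. *)

Import Order.TTheory GRing.Theory Num.Theory.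
Local Open Scope ring_scope.

(** * Polynomials and their values *)

Section MPolyCalculus.
Variable C : numClosedFieldType.

Lemma mpoly_ring_ind n (S : {mpoly C[n]} -> Prop) :
  (forall c, S c%:MP) -> (forall l, S 'X_l) ->
  (forall p q, S p -> S q -> S (p + q)) ->
  (forall p q, S p -> S q -> S (p * q)) -> forall p, S p.
Proof.
move=> SC SX SD SM p; rewrite (mpolyE p).
apply: big_rec => [|a q _ Sq]; first by rewrite -(mpolyC0 n); exact: SC.
apply: (SD) => //; rewrite -mul_mpolyC; apply: (SM) => //.
rewrite mpolyXE_id; apply: (@big_ind _ S).
- by rewrite -(mpolyC1 n); exact: SC.
- exact: SM.
move=> l _; elim: (a l) => [|j IH]; first by rewrite expr0 -(mpolyC1 n).
by rewrite exprS; exact: SM.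
Qed.

Lemma meval_sum n (I : Type) (r : seq I) (P : pred I) (F : I -> {mpoly C[n]}) u :
  (\sum_(i <- r | P i) F i).@[u] = \sum_(i <- r | P i) (F i).@[u].
Proof. exact: raddf_sum. Qed.

Lemma mderivXU n (i j : 'I_n) : ('X_i : {mpoly C[n]})^`M(j) = (i == j)%:R%:MP.
Proof.
rewrite mderivX mnm1E; case: (i =P j) => [->|_]; last by rewrite scale0r mpolyC0.
rewrite scale1r (_ : (U_(j) - U_(j))%MM = 0%MM) ?mpolyX0 ?mpolyC1 //.
by apply/mnmP => l; rewrite mnmBE subnn mnm0E.
Qed.

Lemma mderiv_comp n n' (q : n.-tuple {mpoly C[n']}) (j : 'I_n') (p : {mpoly C[n]}) :
  (p \mPo q)^`M(j) = \sum_(l < n) (p^`M(l) \mPo q) * (tnth q l)^`M(j).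
Proof.
elim/mpoly_ring_ind: p => [c|i|p1 p2 IH1 IH2|p1 p2 IH1 IH2].
- rewrite comp_mpolyC mderivC big1 // => l _.
  by rewrite mderivC comp_mpoly0 mul0r.
- rewrite comp_mpolyXU -tnth_nth (bigD1 i) //= big1 ?addr0 => [|l li].
    by rewrite mderivXU eqxx mpolyC1 comp_mpoly1 mul1r.
  by rewrite mderivXU eq_sym (negbTE li) mpolyC0 comp_mpoly0 mul0r.
- rewrite comp_mpolyD mderivD IH1 IH2 -big_split /=.
  by apply: eq_bigr => l _; rewrite mderivD comp_mpolyD mulrDl.
- rewrite rmorphM mderivM IH1 IH2 mulr_suml mulr_sumr -big_split /=.
  apply: eq_bigr => l _; rewrite mderivM comp_mpolyD !rmorphM /= mulrDl.
  by rewrite mulrAC !mulrA.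
Qed.

(** One variable at a time suffices to deduce the vanishing of all derivatives of
    a polynomial from the vanishing of its values. *)
Lemma mpoly_on_line n (u : 'I_n -> C) (j : 'I_n) (p : {mpoly C[n]}) :
  exists2 q : {poly C},
    forall t, q.[t] = p.@[fun l => u l + (l == j)%:R * t] &
    q^`().[0] = p^`M(j).@[u].
Proof.
elim/mpoly_ring_ind: p => [c|i|p1 p2 [q1 e1 d1] [q2 e2 d2]|p1 p2 [q1 e1 d1] [q2 e2 d2]].
- exists c%:P => [t|]; first by rewrite hornerC mevalC.
  by rewrite derivC mderivC horner0 meval0.
- exists ((u i)%:P + (i == j)%:R *: 'X) => [t|].
    by rewrite mevalXU !hornerE.
  by rewrite derivD derivC derivZ derivX mderivXU mevalC !hornerE.
- exists (q1 + q2) => [t|]; first by rewrite hornerD e1 e2 mevalD.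
  by rewrite derivD hornerD d1 d2 mderivD mevalD.
- exists (q1 * q2) => [t|]; first by rewrite hornerM e1 e2 mevalM.
  rewrite derivM hornerD !hornerM d1 d2 e1 e2 mderivM mevalD !mevalM.
  have E p : p.@[fun l => u l + (l == j)%:R * 0] = p.@[u].
    by apply: meval_eq => l; rewrite mulr0 addr0.
  by rewrite !E.
Qed.

Lemma poly_vanish (q : {poly C}) : (forall t, q.[t] = 0) -> q = 0.
Proof.
move=> q0; apply/eqP/negP => /negP nz.
have := max_poly_roots nz (rs := [seq i%:R : C | i <- iota 0 (size q)]).
rewrite size_map size_iota ltnn => H.
suff : false by []. apply: H.
  by apply/allP => x _; rewrite /root q0.
rewrite map_inj_uniq ?iota_uniq // => x y /eqP.
by rewrite eqr_nat => /eqP.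
Qed.

Lemma mnm_neq0 n (a : 'X_{1..n}) : a != 0%MM -> exists j, a j != 0%N.
Proof.
move=> a0; apply/existsP; apply: contraNT a0; rewrite negb_exists => /forallP H.
by apply/eqP/mnmP => i; rewrite mnm0E; apply/eqP; move: (H i); rewrite negbK.
Qed.

Lemma mcoeff0_meval n (p : {mpoly C[n]}) : p@_0%MM = p.@[fun=> 0].
Proof.
elim/mpoly_ring_ind: p => [c|i|p q IH1 IH2|p q IH1 IH2].
- by rewrite mevalC mcoeffC eqxx mulr1.
- by rewrite mevalXU mcoeffX mnm1_eq0.
- by rewrite mcoeffD mevalD IH1 IH2.
- by rewrite mevalM -IH1 -IH2; exact: (mcoeff0_is_multiplicative n C).1.
Qed.

(** A polynomial that vanishes everywhere has derivatives that vanish everywhere,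
    and in characteristic zero the coefficient of a monomial is, up to a nonzero
    integer, the constant term of an iterated derivative. *)
Lemma mpoly_vanish n (p : {mpoly C[n]}) : (forall u, p.@[u] = 0) -> p = 0.
Proof.
move=> p0; apply/mpolyP => a; rewrite mcoeff0.
elim: {a}(mdeg a) {-2}a (erefl (mdeg a)) p p0 => [|D IH] a aD p p0.
  by move/eqP: aD; rewrite mdeg_eq0 => /eqP ->; rewrite mcoeff0_meval p0.
have [j aj] : exists j, a j != 0%N.
  by apply: mnm_neq0; rewrite -mdeg_eq0 aD.
pose b := (a - U_(j))%MM.
have ab : a = (b + U_(j))%MM by rewrite submK // lep1mP.
have bD : mdeg b = D by apply/eqP; rewrite -eqSS -aD ab mdegD mdeg1 addn1.
have dp0 u : (p^`M(j)).@[u] = 0.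
  have [q qe <-] := mpoly_on_line u j p.
  by rewrite (_ : q = 0) ?linear0 ?horner0 //; apply: poly_vanish => t; rewrite qe.
have := IH b bD _ dp0; rewrite mcoeff_deriv -ab => /eqP.
by rewrite mulrn_eq0 /= => /eqP.
Qed.

Lemma mpoly_eval_inj n (p q : {mpoly C[n]}) : (forall u, p.@[u] = q.@[u]) -> p = q.
Proof.
by move=> pq; apply/subr0_eq/mpoly_vanish => u; rewrite mevalB pq subrr.
Qed.

End MPolyCalculus.

(** * Products of powers of linear forms *)

Section GroupedForms.
Variables (C : numClosedFieldType) (N k : nat) (grp : 'I_N -> 'I_k).
Implicit Types (u p : 'I_N -> C) (e : 'I_k -> nat) (a : 'X_{1..N}).

(** The variables are numbered in one sequence and [grp] tells which of the [k]
    groups each belongs to.  A tuple of vectors is thus a single function [u], and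
    [gdot i] is the standard bilinear form on its [i]-th component. *)
Definition gdot i u p : C := \sum_(l | grp l == i) u l * p l.
Definition gdeg a i : nat := \sum_(l | grp l == i) a l.
Definition lform u i : {mpoly C[N]} := \sum_(l | grp l == i) u l *: 'X_l.
Definition pform e u : {mpoly C[N]} := \prod_(i < k) lform u i ^+ e i.
(** Subtraction is truncated, so this is [e] itself when [e j = 0]; the places that
    use it then carry the factor [e j]. *)
Definition lower_at e j : 'I_k -> nat := fun i => (e i - (i == j))%N.
Definition mfact a : nat := \prod_(l < N) (a l)`!.

Lemma meval_lform u i p : (lform u i).@[p] = gdot i u p.
Proof.
by rewrite raddf_sum /=; apply: eq_bigr => l _; rewrite mevalZ mevalXU.
Qed.

Lemma meval_pform e u p : (pform e u).@[p] = \prod_(i < k) gdot i u p ^+ e i.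
Proof.
by rewrite rmorph_prod /=; apply: eq_bigr => i _; rewrite rmorphXn /= meval_lform.
Qed.

Lemma mderiv_lform u i l : (lform u i)^`M(l) = ((grp l == i)%:R * u l)%:MP.
Proof.
rewrite /lform (linear_sum (mderiv l)) /=.
under eq_bigr => j _ do rewrite mderivZ mderivXU -mul_mpolyC -mpolyCM.
rewrite -rmorph_sum /=; congr (_%:MP).
rewrite big_mkcond /= (bigD1 l) //= big1 ?addr0 => [|j jl].
  by case: ifP; rewrite ?eqxx ?mulr1 ?mul1r ?mul0r.
by rewrite (negbTE jl) mulr0; case: ifP.
Qed.

Lemma mderiv_exp (p : {mpoly C[N]}) n l :
  (p ^+ n)^`M(l) = n%:R * p ^+ n.-1 * p^`M(l).
Proof.
elim: n => [|n IH]; first by rewrite expr0 -(mpolyC1 N) mderivC !mul0r.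
rewrite exprS mderivM IH /=; case: n {IH} => [|n] /=.
  by rewrite expr0 !mul0r mulr0 addr0 !mulr1 mul1r.
rewrite exprS; ring.
Qed.

Lemma pform_pull e u j : (0 < e j)%N ->
  pform e u = lform u j * pform (lower_at e j) u.
Proof.
move=> ej; rewrite /pform (bigD1 j) //= [in RHS](bigD1 j) //= mulrA.
rewrite /lower_at eqxx -exprS subn1 prednK //; congr (_ * _).
by apply: eq_bigr => i /negbTE ->; rewrite subn0.
Qed.

Lemma mderiv_pform e u l :
  (pform e u)^`M(l) = ((e (grp l))%:R * u l) *: pform (lower_at e (grp l)) u.
Proof.
set j := grp l.
have H : (\prod_(i < k | i != j) lform u i ^+ e i)^`M(l) = 0.
  apply: (big_ind (fun q => q^`M(l) = 0)) => [|q1 q2 H1 H2|i ij].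
  - by rewrite -(mpolyC1 N) mderivC.
  - by rewrite mderivM H1 H2 mul0r mulr0 addr0.
  - by rewrite mderiv_exp mderiv_lform eq_sym (negbTE ij) mul0r mpolyC0 mulr0.
rewrite /pform (bigD1 j) //= mderivM H mulr0 addr0 mderiv_exp mderiv_lform.
rewrite eqxx mul1r [in RHS](bigD1 j) //= /lower_at eqxx subn1.
under [in RHS]eq_bigr => i /negbTE ij do rewrite ij subn0.
by rewrite -mul_mpolyC mpolyCM mpolyC_nat; ring.
Qed.

(** The logarithmic derivative of a product of powers, freed of denominators. *)
Lemma lform_mderiv_pform e u l :
  lform u (grp l) * (pform e u)^`M(l) = ((e (grp l))%:R * u l) *: pform e u.
Proof.
rewrite mderiv_pform; have [->|e0] := posnP (e (grp l)).
  by rewrite mul0r !scale0r mulr0.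
by rewrite -scalerAr -pform_pull.
Qed.

Lemma mfactU a j : mfact (a + U_(j))%MM = (mfact a * (a j).+1)%N.
Proof.
rewrite /mfact (bigD1 j) //= [in RHS](bigD1 j) //= mnmDE mnm1E eqxx addn1 factS.
rewrite [in RHS]mulnC mulnA; congr (_ * _)%N; apply: eq_bigr => l lj.
by rewrite mnmDE mnm1E eq_sym (negbTE lj) addn0.
Qed.

Lemma gdegU a j i : gdeg (a + U_(j))%MM i = (gdeg a i + (grp j == i))%N.
Proof.
rewrite /gdeg; under eq_bigr do rewrite mnmDE.
rewrite big_split /=; congr (_ + _)%N.
rewrite big_mkcond /= (bigD1 j) //= big1 => [|l lj].
  by rewrite addn0 mnm1E eqxx; case: ifP.
by rewrite mnm1E [j == l]eq_sym (negbTE lj); case: ifP.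
Qed.

(** The multinomial theorem, one group of variables at a time.  Differentiation
    sends a product of powers to another one, so the coefficients can be computed by
    induction on the monomial instead of expanding the product. *)
Lemma mcoeff_pform e u a :
  (mfact a)%:R * (pform e u)@_a =
    if [forall i, gdeg a i == e i]
    then (\prod_(i < k) (e i)`!)%N%:R * \prod_(l < N) u l ^+ a l else 0.
Proof.
elim: {a}(mdeg a) {-2}a (erefl (mdeg a)) e => [|D IH] a aD e.
  move/eqP: aD; rewrite mdeg_eq0 => /eqP ->.
  rewrite mcoeff0_meval meval_pform /mfact big1 ?mul1r => [|l _]; last first.
    by rewrite mnm0E fact0.
  rewrite [X in _ * X]big1 ?mulr1 => [|l _]; last by rewrite mnm0E.
  have g0 i : gdeg 0%MM i = 0%N by rewrite /gdeg big1 // => l _; rewrite mnm0E.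
  have d0 i : gdot i u (fun=> 0) = 0 by rewrite /gdot big1 // => l _; rewrite mulr0.
  under eq_bigr do rewrite d0.
  case: ifPn => [/forallP H|/forallPn /= [ i ]].
    have e0 i : e i = 0%N by move: (H i); rewrite g0 => /eqP.
    by rewrite !big1 // => i _; rewrite e0 ?fact0 ?expr0.
  rewrite g0 eq_sym => ei.
  by rewrite (bigD1 i) //= expr0n (negbTE ei) mul0r.
have [j aj] : exists j, a j != 0%N by apply: (@mnm_neq0); rewrite -mdeg_eq0 aD.
pose b := (a - U_(j))%MM.
have ab : a = (b + U_(j))%MM by rewrite submK // lep1mP.
have bD : mdeg b = D by apply/eqP; rewrite -eqSS -aD ab mdegD mdeg1 addn1.
rewrite ab mfactU natrM -mulrA [X in _ * X]mulr_natl -mcoeff_deriv.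
rewrite mderiv_pform mcoeffZ mulrCA IH //.
have [e0|e0] := posnP (e (grp j)).
  rewrite e0 !mul0r; case: ifPn => // /forallP /(_ (grp j)).
  by rewrite gdegU eqxx addn1 e0.
have -> : [forall i, gdeg b i == lower_at e (grp j) i] =
          [forall i, gdeg (b + U_(j))%MM i == e i].
  apply: eq_forallb => i; rewrite gdegU /lower_at eq_sym.
  have [->|ij] := eqVneq i (grp j); last by rewrite subn0 addn0 eq_sym.
  by rewrite subn1 addn1 -[in RHS](prednK e0) eqSS eq_sym.
case: ifP => _; last by rewrite mulr0.
have -> : (\prod_(i < k) (e i)`!)%N = (e (grp j) * \prod_(i < k) (lower_at e (grp j) i)`!)%N.
  rewrite (bigD1 (grp j)) //= [in RHS](bigD1 (grp j)) //= mulnA; congr (_ * _)%N.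
    by rewrite /lower_at eqxx subn1 -{1 2}(prednK e0) factS.
  by apply: eq_bigr => i /negbTE ij; rewrite /lower_at ij subn0.
have -> : \prod_(l < N) u l ^+ (b + U_(j))%MM l = u j * \prod_(l < N) u l ^+ b l.
  rewrite (bigD1 j) //= [in RHS](bigD1 j) //= mulrA; congr (_ * _).
    by rewrite mnmDE mnm1E eqxx addn1 exprS.
  by apply: eq_bigr => l lj; rewrite mnmDE mnm1E eq_sym (negbTE lj) addn0.
by rewrite natrM; ring.
Qed.

Lemma gscale_monomial (r : 'I_k -> C) u a :
  \prod_(l < N) (r (grp l) * u l) ^+ a l =
  (\prod_(i < k) r i ^+ gdeg a i) * \prod_(l < N) u l ^+ a l.
Proof.
under eq_bigr do rewrite exprMn.
rewrite big_split /=; congr (_ * _).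
rewrite (partition_big grp xpredT) //=; apply: eq_bigr => i _.
by rewrite -prodrXr; apply: eq_bigr => l /eqP ->.
Qed.

End GroupedForms.

Lemma mfact_neq0 (C : numClosedFieldType) N (a : 'X_{1..N}) : (mfact a)%:R != 0 :> C.
Proof. by rewrite pnatr_eq0 -lt0n prodn_gt0 // => l; rewrite fact_gt0. Qed.

(** The Bombieri-Weyl weight of a monomial is the inverse of its coefficient in a
    power of a generic linear form, so pairing with such a power is evaluation. *)
Lemma bw_form_power (C : numClosedFieldType) N omega (f : {mpoly C[N]}) (c : 'I_N -> C) :
  f \is omega.-homog ->
  bw_form omega`! f ((\sum_(l < N) c l *: 'X_l) ^+ omega) = f.@[c].
Proof.
move=> /dhomogP hf; rewrite mevalE /bw_form big_seq [RHS]big_seq.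
apply: eq_bigr => a af.
have := @mcoeff_pform C N 1 (fun=> ord0) (fun=> omega) c a.
have ha : mdeg a = omega := hf _ af.
rewrite /pform !big_ord1 /lform big_mkcond /=.
have -> : [forall i : 'I_1, gdeg (fun _ : 'I_N => ord0) a i == omega].
  apply/forallP => i; rewrite /gdeg -ha mdegE big_mkcond /=.
  by rewrite (eq_bigr (fun l => a l)) // => l _; rewrite (ord1 i) eqxx.
rewrite (eq_bigr (fun l => c l *: 'X_l)) // => H.
have w0 : omega`!%:R != 0 :> C by rewrite pnatr_eq0 -lt0n fact_gt0.
rewrite -!mulrA; congr (_ * _).
by rewrite mulrA [X in X / _]mulrC H mulrAC mulfV // mul1r.
Qed.

(** * Orthonormal coordinates and the Segre-Veronese map *)

Section Coordinates.
Variables (C : numClosedFieldType) (k : nat) (m : 'I_k -> nat).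
Local Notation n := (nvars m).
Implicit Types (u p : 'I_n -> C) (a : 'X_{1..n}) (v : vectors C m).

Definition grp (l : 'I_n) : 'I_k := tag (enum_val l).

Lemma grp_vnum i (j : 'I_(m i).+1) : grp (vnum j) = i.
Proof. by rewrite /grp /vnum enum_rankK. Qed.

Lemma big_vnum (T : Type) (idx : T) (op : Monoid.com_law idx) i (F : 'I_n -> T) :
  \big[op/idx]_(j < (m i).+1) F (vnum j) = \big[op/idx]_(l | grp l == i) F l.
Proof.
rewrite [RHS](reindex (@enum_rank (var m))) /=; last first.
  by exists enum_val => x _; rewrite ?enum_rankK ?enum_valK.
under [RHS]eq_bigl => x do rewrite /grp enum_rankK.
have := @sig_big_dep T idx op 'I_k (fun i => 'I_(m i).+1) (pred1 i)
  (fun _ _ => true) (fun i j => F (vnum j)).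
rewrite big_pred1_eq => ->; apply: eq_big => [x|x _] /=; first by rewrite andbT.
by case: x.
Qed.

Lemma multidegE a i : multideg a i = gdeg grp a i.
Proof. exact: big_vnum. Qed.

Definition unflat u : vectors C m := fun i => \row_j u (vnum j).

Lemma coords_unflat u : coords (unflat u) =1 u.
Proof.
move=> l; rewrite /coords /unflat mxE /vnum.
by rewrite -[in RHS](enum_valK l); case: (enum_val l).
Qed.

Lemma unflat_eq0 u i l : unflat u i = 0 :> 'rV[C]_(m i).+1 -> grp l = i -> u l = 0.
Proof.
move=> ui li; rewrite -(coords_unflat u) /coords.
by move: (tagged _); rewrite -/(grp l) li ui => j; rewrite mxE.
Qed.

Lemma coords_vnum v i (j : 'I_(m i).+1) : coords v (vnum j) = v i 0 j.
Proof. by rewrite /coords /vnum enum_rankK. Qed.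

Lemma tensor_powE e v : tensor_pow e v = pform grp e (coords v).
Proof.
apply: eq_bigr => i _; congr (_ ^+ _).
rewrite /lform -(big_vnum _ _ (fun l => coords v l *: 'X_l)).
by apply: eq_bigr => j _; rewrite coords_vnum.
Qed.

Lemma eq_pform e u u' : u =1 u' -> pform grp e u = pform grp e u' :> {mpoly C[n]}.
Proof.
move=> uu; apply: eq_bigr => i _; congr (_ ^+ _).
by apply: eq_bigr => l _; rewrite uu.
Qed.

Lemma tensor_pow_unflat e u : tensor_pow e (unflat u) = pform grp e u.
Proof. by rewrite tensor_powE; apply/eq_pform/coords_unflat. Qed.

Variable d : 'I_k -> nat.
Local Notation V := 'rV[C]_(dimV m d).
Implicit Types (y z : V).

Lemma exponentP (l : 'I_(dimV m d)) i : gdeg grp (exponent l) i = d i.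
Proof.
have := enum_valP l; rewrite inE => /forallP /(_ i) /eqP <-.
by rewrite multidegE.
Qed.

Lemma exponent_inj : injective (@exponent k m d).
Proof. by move=> l l' /val_inj /enum_val_inj. Qed.

(** The total degree of a monomial of multidegree [d] is the sum of the [d i], so the
    bound imposed on the exponents of the basis excludes nothing. *)
Lemma exponent_surj a : (forall i, gdeg grp a i = d i) ->
  exists l : 'I_(dimV m d), exponent l = a.
Proof.
move=> ad; have lt_a : (mdeg a < (\sum_(i < k) d i).+1)%N.
  rewrite ltnS mdegE (partition_big grp xpredT) //=.
  by apply: leq_sum => i _; rewrite -ad.
have ain : BMultinom lt_a \in exponents m d.
  by rewrite inE; apply/forallP => i; rewrite multidegE /= ad.
by exists (enum_rank_in ain (BMultinom lt_a)); rewrite /exponent enum_rankK_in.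
Qed.

Lemma mdeg_exponent (l : 'I_(dimV m d)) : mdeg (exponent l) = (\sum_(i < k) d i)%N.
Proof.
rewrite mdegE (partition_big grp xpredT) //=.
by apply: eq_bigr => i _; rewrite -(exponentP l i).
Qed.

Definition bw_scale (l : 'I_(dimV m d)) : C := sqrtC (multibinom C d (exponent l)).

Lemma bw_scale_sq l :
  bw_scale l ^+ 2 * (mfact (exponent l))%:R = (\prod_(i < k) (d i)`!)%N%:R.
Proof. by rewrite sqrtCK /multibinom divfK // mfact_neq0. Qed.

Lemma bw_scale_neq0 l : bw_scale l != 0.
Proof.
have : (\prod_(i < k) (d i)`!)%N%:R != 0 :> C.
  by rewrite pnatr_eq0 -lt0n prodn_gt0 // => i; rewrite fact_gt0.
by rewrite -(bw_scale_sq l); apply: contraNneq => ->; rewrite expr0n mul0r.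
Qed.

Lemma bw_basisE l : bw_basis C l = bw_scale l *: 'X_[exponent l].
Proof. by []. Qed.

Definition veronese u : V := \row_l (bw_basis C l).@[u].

Lemma veroneseE u l : veronese u 0 l = bw_scale l * \prod_(j < n) u j ^+ exponent l j.
Proof. by rewrite mxE bw_basisE mevalZ mevalX. Qed.

Lemma eq_veronese u u' : u =1 u' -> veronese u = veronese u'.
Proof. by move=> uu; apply/rowP => l; rewrite !mxE; apply: meval_eq. Qed.

(** Scaling the components of [u] separately is used to normalize them, to clear
    denominators, and, with factors 0 and 1, to kill a component. *)
Lemma veronese_gscale (r : 'I_k -> C) u :
  veronese (fun l => r (grp l) * u l) = (\prod_(i < k) r i ^+ d i) *: veronese u.
Proof.
apply/rowP => l; rewrite !mxE !bw_basisE !mevalZ !mevalX gscale_monomial.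
by under eq_bigr do rewrite exponentP; rewrite mulrCA.
Qed.

Lemma veronese_monomial (a : 'X_{1..dimV m d}) u :
  \prod_l veronese u 0 l ^+ a l =
  (\prod_l bw_scale l ^+ a l) *
  \prod_(j < n) u j ^+ [multinom (\sum_l exponent l i * a l)%N | i < n] j.
Proof.
under eq_bigr do rewrite veroneseE exprMn.
rewrite big_split /=; congr (_ * _).
under [RHS]eq_bigr do rewrite mnmE -prodrXr.
rewrite exchange_big /=; apply: eq_bigr => l _.
by rewrite -prodrXl; apply: eq_bigr => j _; rewrite exprM.
Qed.

Lemma veronese_eq0 (hd : forall i, (0 < d i)%N) u i :
  unflat u i = 0 :> 'rV[C]_(m i).+1 -> veronese u = 0.
Proof.
move=> ui; have u0 l : grp l = i -> u l = 0 := unflat_eq0 ui.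
pose rr (j : 'I_k) : C := (j != i)%:R.
rewrite (@eq_veronese _ (fun l => rr (grp l) * u l)) => [|l].
  rewrite veronese_gscale (bigD1 i) //= /rr eqxx expr0n.
  by rewrite (gtn_eqF (hd i)) mul0r scale0r.
rewrite /rr; have [li|li] := eqVneq (grp l) i; last by rewrite mul1r.
by rewrite u0 ?mulr0.
Qed.

Lemma meval_toV y p : (toV y).@[p] = \sum_l y 0 l * (bw_basis C l).@[p].
Proof. by rewrite raddf_sum; apply: eq_bigr => l _; rewrite /= mevalZ. Qed.

Lemma mcoeff_toV_out y a : ~ (forall i, gdeg grp a i = d i) -> (toV y)@_a = 0.
Proof.
move=> ad; rewrite raddf_sum big1 // => l _ /=.
rewrite mcoeffZ bw_basisE mcoeffZ mcoeffX; case: eqP => [la|]; last by rewrite !mulr0.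
by case: ad => i; rewrite -la exponentP.
Qed.

Lemma mcoeff_toV y l : (toV y)@_(exponent l) = y 0 l * bw_scale l.
Proof.
rewrite raddf_sum (bigD1 l) //= big1 ?addr0 => [|l' ll'].
  by rewrite mcoeffZ bw_basisE mcoeffZ mcoeffX eqxx mulr1.
rewrite mcoeffZ bw_basisE mcoeffZ mcoeffX.
by case: eqP => [/exponent_inj /eqP|]; rewrite ?(negbTE ll') ?mulr0.
Qed.

Lemma toV_inj : injective (@toV C k m d).
Proof.
move=> y z yz; apply/rowP => l; apply: (mulIf (bw_scale_neq0 l)).
by rewrite -!mcoeff_toV yz.
Qed.

Lemma toV_is_linear c y z : toV (c *: y + z) = c *: toV y + toV z.
Proof.
rewrite scaler_sumr -big_split; apply: eq_bigr => l _ /=.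
by rewrite !mxE scalerDl scalerA.
Qed.

Lemma toV0 : toV (0 : V) = 0.
Proof. by rewrite /toV big1 // => l _; rewrite mxE scale0r. Qed.

Lemma toVZ c y : toV (c *: y) = c *: toV y.
Proof.
rewrite scaler_sumr; apply: eq_bigr => l _ /=.
by rewrite !mxE scalerA.
Qed.

(** The basis is rescaled so that its value at [u] equals the coefficient on it of
    the product of powers of the linear forms given by [u]: the square of the scaling
    factor is the multinomial coefficient. *)
Lemma pform_toV u : pform grp d u = toV (veronese u).
Proof.
apply/mpolyP => a; apply: (mulfI (mfact_neq0 C a)); rewrite mcoeff_pform.
case: ifPn => [/forallP ad|/forallP ad].
  have [l <-] := exponent_surj (fun i => eqP (ad i)).
  by rewrite mcoeff_toV veroneseE -(bw_scale_sq l); ring.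
by rewrite mcoeff_toV_out ?mulr0 // => H; apply: ad => i; apply/eqP.
Qed.

(** Both sides are the value at [p] of the product of powers given by [u]. *)
Lemma sum_veronese u p :
  \sum_l veronese u 0 l * veronese p 0 l = \prod_(i < k) gdot grp i u p ^+ d i.
Proof.
rewrite -meval_pform pform_toV meval_toV.
by apply: eq_bigr => l _; rewrite [in LHS]mxE [veronese p 0 l]mxE [in RHS]mxE.
Qed.

(** The scaled monomials are orthonormal. *)
Lemma bw_toV y z : bw d (toV y) (toV z) = \sum_l y 0 l * z 0 l.
Proof.
rewrite /bw /bw_form.
pose F a := (toV y)@_a * (toV z)@_a *
   ((mfact a)%:R / (\prod_(i < k) (d i)`!)%N%:R).
have -> : \sum_l y 0 l * z 0 l = \sum_(l < dimV m d) F (exponent l).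
  apply: eq_bigr => l _; rewrite /F !mcoeff_toV -(bw_scale_sq l).
  have := mfact_neq0 C (exponent l); have := bw_scale_neq0 l.
  by move=> s0 a0; field; rewrite s0 a0.
transitivity (\sum_(a <- [seq exponent l | l <- enum 'I_(dimV m d)] |
               a \in msupp (toV y)) F a).
  rewrite -[RHS]big_filter; apply: perm_big; apply: uniq_perm.
  - exact: msupp_uniq.
  - by rewrite filter_uniq // map_inj_uniq ?enum_uniq //; exact: exponent_inj.
  move=> a; rewrite mem_filter; case: (boolP (a \in _)) => //= ain.
  have [ad|ad] := pselect (forall i, gdeg grp a i = d i); last first.
    by move: ain; rewrite mcoeff_msupp mcoeff_toV_out ?eqxx.
  by have [l <-] := exponent_surj ad; rewrite map_f // mem_enum.
rewrite big_mkcond big_map big_enum /=; apply: eq_bigr => l _.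
case: ifPn => // nin; rewrite /F (memN_msupp_eq0 nin) !mul0r.
by [].
Qed.

Lemma bw_basis_toV l : bw_basis C l = toV (delta_mx 0 l : V).
Proof.
rewrite /toV (bigD1 l) //= big1 ?addr0 => [|l' ll']; rewrite mxE eqxx ?eqxx ?scale1r //.
by rewrite (negbTE ll') scale0r.
Qed.

Lemma bw_toV_basis y l : bw d (toV y) (bw_basis C l) = y 0 l.
Proof.
rewrite bw_basis_toV bw_toV (bigD1 l) //= big1 ?addr0 => [|l' ll'].
  by rewrite mxE !eqxx mulr1.
by rewrite mxE (negbTE ll') andbF mulr0.
Qed.

Lemma sym_pow_toV omega y :
  sym_pow d omega (toV y) = (\sum_l y 0 l *: 'X_l) ^+ omega.
Proof. by congr (_ ^+ _); apply: eq_bigr => l _; rewrite bw_toV_basis. Qed.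

(** Each basis monomial is an eigenvector of the [i]-th Euler operator, with its partial
    degree [d i] as eigenvalue. *)
Lemma euler_toV y u i :
  \sum_(p | grp p == i) u p * ((toV y)^`M(p)).@[u] = (d i)%:R * (toV y).@[u].
Proof.
have mono a : \sum_(p | grp p == i) u p * ('X_[C, a]^`M(p)).@[u] =
    (gdeg grp a i)%:R * 'X_[C, a].@[u].
  rewrite /gdeg natr_sum mulr_suml; apply: eq_bigr => p _.
  rewrite mderivX mevalZ !mevalX mulrCA.
  case: (posnP (a p)) => [->|ap]; first by rewrite !mul0r.
  congr (_ * _); rewrite (bigD1 p) //= [in RHS](bigD1 p) //= mulrA; congr (_ * _).
    by rewrite mnmBE mnm1E eqxx subn1 -exprS prednK.
  by apply: eq_bigr => l lp; rewrite mnmBE mnm1E eq_sym (negbTE lp) subn0.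
have -> : \sum_(p | grp p == i) u p * ((toV y)^`M(p)).@[u] =
    \sum_(p | grp p == i) \sum_l (y 0 l * bw_scale l) * (u p * ('X_[C, exponent l]^`M(p)).@[u]).
  apply: eq_bigr => p _; rewrite (linear_sum (mderiv p)) raddf_sum /= mulr_sumr.
  apply: eq_bigr => l _; rewrite mderivZ bw_basisE mderivZ !mevalZ.
  by ring.
rewrite exchange_big /= meval_toV mulr_sumr; apply: eq_bigr => l _.
by rewrite -mulr_sumr mono exponentP bw_basisE mevalZ; ring.
Qed.

End Coordinates.

(** * The projection onto the span of the powers *)

(** Linearly independent functions on a set stay independent on a suitable finite
    sample: as long as the sampled matrix has fewer rows than columns, some nonzero
    combination [c] of the functions vanishes on the sample, and a point where [c]
    does not vanish gives a further independent row. *)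
Lemma row_free_sampling (K : fieldType) (X : Type) N (F : X -> 'rV[K]_N) (x0 : X) :
  (forall c : 'cV_N, (forall x, F x *m c = 0) -> c = 0) ->
  forall r, (r <= N)%N -> exists x : nat -> X, row_free (\matrix_(s < r) F (x s)).
Proof.
move=> FN; elim=> [|r IH] rN.
  exists (fun=> x0); apply: inj_row_free => w _; apply/rowP => -[].
  by [].
have [x xfree] := IH (ltnW rN).
set A := \matrix_(s < r) F (x s) in xfree.
have coker0 : cokermx A != 0.
  rewrite -mxrank_eq0 mxrank_coker subn_eq0 -ltnNge.
  exact: leq_ltn_trans (rank_leq_row _) rN.
have [j cj0] : exists j, col j (cokermx A) != 0.
  apply/not_existsP => H; case/eqP: coker0; apply/matrixP => i j.
  have /negP := H j; rewrite negbK => /eqP /colP /(_ i).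
  by rewrite !mxE.
set c := col j _ in cj0.
have Ac : A *m c = 0 by rewrite /c colE mulmxA mulmx_coker mul0mx.
have [xr xr0] : exists x, F x *m c != 0.
  apply/not_existsP => H; case/eqP: cj0; apply: FN => y.
  by apply/eqP; have /negP := H y; rewrite negbK.
have Fx s : (s < r)%N -> F (x s) *m c = 0.
  move=> sr; have := congr1 (row (Ordinal sr)) Ac.
  by rewrite row_mul rowK row0.
exists (fun s => if (s < r)%N then x s else xr); apply: inj_row_free => w.
rewrite mulmx_sum_row big_ord_recr /= rowK /= ltnn.
under eq_bigr => i _ do rewrite rowK /= ltn_ord.
move=> wA.
have wr : w 0 ord_max = 0.
  have /eqP := congr1 (mulmx^~ c) wA.
  rewrite mul0mx mulmxDl mulmx_suml big1 ?add0r => [|i _]; last first.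
    by rewrite -scalemxAl Fx ?scaler0.
  by rewrite -scalemxAl scaler_eq0 (negbTE xr0) orbF => /eqP.
move: wA; rewrite wr scale0r addr0 => wA.
have w0 : \row_(i < r) w 0 (widen_ord (leqnSn r) i) = 0.
  apply: (row_free_inj xfree); rewrite mul0mx -[RHS]wA mulmx_sum_row.
  by apply: eq_bigr => i _; rewrite rowK mxE.
apply/rowP => i; rewrite [RHS]mxE; have [ir|ir] := ltnP i r.
  have /rowP /(_ (Ordinal ir)) := w0; rewrite !mxE => <-.
  by congr (w 0 _); apply: val_inj.
rewrite (_ : i = ord_max) //; apply: val_inj => /=.
by apply/eqP; rewrite eqn_leq ir -ltnS ltn_ord.
Qed.

Section Projection.
Variables (C : numClosedFieldType) (k : nat) (m : 'I_k -> nat).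
Local Notation n := (nvars m).

(** Powers span because a form orthogonal to all of them vanishes at every point. *)
Lemma veronese_span (d : 'I_k -> nat) (z : 'rV[C]_(dimV m d)) :
  exists (r : nat) (c : 'I_r -> C) (x : 'I_r -> 'I_n -> C),
    z = \sum_(s < r) c s *: veronese d (x s).
Proof.
have [|x xfree] := row_free_sampling (F := @veronese C k m d) (fun=> 0) _ (leqnn _).
  move=> c c0; apply/trmx_inj; rewrite trmx0; apply: toV_inj.
  rewrite toV0; apply: mpoly_vanish => u; rewrite meval_toV.
  transitivity ((veronese d u *m c) 0 0); last by rewrite c0 mxE.
  by rewrite mxE; apply: eq_bigr => l _; rewrite !mxE mulrC.
set A := (X in row_free X) in xfree.
exists (dimV m d), (fun s => (z *m invmx A) 0 s), (fun s => x s).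
have Au : A \in unitmx by rewrite -row_free_unit.
rewrite -[LHS](mulmxKV Au) mulmx_sum_row.
by apply: eq_bigr => s _; rewrite rowK.
Qed.

Lemma homog_meval N omega (f : {mpoly C[N]}) (c : C) (y : 'I_N -> C) :
  f \is omega.-homog -> f.@[fun l => c * y l] = c ^+ omega * f.@[y].
Proof.
move=> /dhomogP hf; rewrite !mevalE mulr_sumr big_seq [RHS]big_seq.
apply: eq_bigr => a af.
have ha : mdeg a = omega := hf _ af.
under eq_bigr do rewrite exprMn.
by rewrite big_split /= prodrXr -mdegE ha mulrCA.
Qed.

Variable d : 'I_k -> nat.
Hypothesis hd : forall i, (0 < d i)%N.
Variable omega : nat.
Hypothesis homega : (0 < omega)%N.
Local Notation e := (fun i => omega * d i)%N.
Variable f : {mpoly C[dimV m d]}.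
Hypothesis hf : f \is omega.-homog.

(** Substituting the monomials [veronese u] into a monomial of degree [omega] gives a
    scalar times a monomial of multidegree [omega * d]. *)
Lemma restriction_multihomog :
  exists z : 'rV[C]_(dimV m e), forall u, f.@[veronese d u 0] = (toV z).@[u].
Proof.
have fdeg : forall a, a \in msupp f -> mdeg a = omega.
  by move: hf => /dhomogP hf' a af; exact: hf'.
suff [z zE] : exists z : 'rV[C]_(dimV m e), forall u,
    \sum_(a <- msupp f) f@_a * \prod_l veronese d u 0 l ^+ a l = (toV z).@[u].
  by exists z => u; rewrite mevalE zE.
elim: (msupp f) fdeg => [|a s IH] fdeg.
  exists 0 => u; rewrite big_nil meval_toV big1 // => l _.
  by rewrite mxE mul0r.
have [|z zE] := IH; first by move=> b bs; apply: fdeg; rewrite inE bs orbT.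
pose b := [multinom (\sum_l exponent l j * a l)%N | j < n].
have [l' l'b] : exists l : 'I_(dimV m e), exponent l = b.
  apply: exponent_surj => i; rewrite /gdeg; under eq_bigr do rewrite mnmE.
  rewrite exchange_big /= -(fdeg a) ?mem_head // mdegE big_distrl /=.
  by apply: eq_bigr => l _; rewrite -big_distrl /= -(exponentP l i) mulnC.
exists ((f@_a * (\prod_l bw_scale C l ^+ a l) / bw_scale C l') *: delta_mx 0 l' + z) => u.
rewrite big_cons zE toV_is_linear mevalD mevalZ -bw_basis_toV; congr (_ + _).
rewrite bw_basisE mevalZ mulrA divfK ?bw_scale_neq0 // -mulrA; congr (_ * _).
by rewrite veronese_monomial l'b mevalX.
Qed.

Lemma homog_pairing (y : 'I_(dimV m d) -> C) : (\sum_(l < dimV m d) y l *: 'X_l) ^+ omega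
  \is [in C[dimV m d], omega.-homog].
Proof.
rewrite -[X in X.-homog]mul1n; apply: dhomogMn; apply: rpred_sum => l _.
by apply: dhomogZ; rewrite dhomogX; apply/eqP/mdeg1.
Qed.

Lemma sym_pow_tensor (v : vectors C m) :
  sym_pow d omega (tensor_pow d v) =
  (\sum_l veronese d (coords v) 0 l *: 'X_l : {mpoly C[dimV m d]}) ^+ omega.
Proof. by rewrite tensor_powE pform_toV sym_pow_toV. Qed.

(** This is why the identification of the span of the powers with the forms of
    multidegree [omega * d] is the restriction of functions to the cone. *)
Lemma meval_sym_pow_tensor (v : vectors C m) u :
  (sym_pow d omega (tensor_pow d v)).@[veronese d u 0] =
  (tensor_pow e v).@[u].
Proof.
rewrite sym_pow_tensor rmorphXn /= raddf_sum /= tensor_powE meval_pform.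
under eq_bigr do rewrite mevalZ mevalXU.
rewrite sum_veronese -prodrXl; apply: eq_bigr => i _.
by rewrite -exprM mulnC.
Qed.

Lemma homog_combination r (c : 'I_r -> C) (v : 'I_r -> vectors C m) :
  f - \sum_(s < r) c s *: sym_pow d omega (tensor_pow d (v s)) \is omega.-homog.
Proof.
apply: rpredB => //; apply: rpred_sum => s _; apply: dhomogZ.
by rewrite sym_pow_tensor; apply: homog_pairing.
Qed.

(** Write the restriction of [f] to the cone as a combination of products of powers;
    the same combination of the powers [sym_pow] agrees with [f] on the cone, and
    the reproducing property turns this into orthogonality. *)
Lemma is_proj_exists : exists g, is_proj omega f g.
Proof.
have [z zE] := restriction_multihomog.
have [r [c [x xE]]] := veronese_span z.
exists (\sum_(s < r) c s *: tensor_pow e (unflat (x s))).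
exists r, c, (fun s => unflat (x s)); split=> // phi [c0 [v [_ ->]]].
rewrite tensor_powE pform_toV -toVZ sym_pow_toV bw_form_power; last first.
  exact: homog_combination.
rewrite (@meval_eq _ _ _ (fun l => c0 * veronese d (coords v) 0 l)); last first.
  by move=> l; rewrite mxE.
rewrite (homog_meval _ _ (homog_combination _ _)) mevalB meval_sum zE xE.
rewrite -[X in _ * (X - _)](_ : \sum_(s < r) c s * (tensor_pow e (unflat (x s))).@[coords v] = _).
  rewrite -sumrB big1 ?mulr0 // => s _.
  by rewrite mevalZ meval_sym_pow_tensor subrr.
rewrite meval_toV.
under [RHS]eq_bigr do rewrite summxE mulr_suml.
rewrite exchange_big /=; apply: eq_bigr => s _.
rewrite tensor_pow_unflat meval_pform -sum_veronese mulr_sumr.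
apply: eq_bigr => l _; rewrite [in RHS]mxE -mulrA; congr (_ * (_ * _)); by rewrite mxE.
Qed.

(** Orthogonality gives equality of the values at points of the cone.  A tuple with a
    zero component is mapped to the vertex, where both sides vanish as all degrees
    are positive. *)
Lemma is_proj_meval g : is_proj omega f g -> forall u, g.@[u] = f.@[veronese d u 0].
Proof.
move=> [r [c [v [orth ->]]]] u; rewrite raddf_sum /=.
under eq_bigr do rewrite mevalZ.
have [nz|] := pselect (forall i, unflat u i != 0); last first.
  move=> /existsNP [i /negP]; rewrite negbK => /eqP ui.
  rewrite (veronese_eq0 hd ui).
  rewrite [RHS](@meval_eq _ _ _ (fun l => 0 * 0)); last by move=> l; rewrite mxE mulr0.
  rewrite (homog_meval _ _ hf) expr0n (gtn_eqF homega) mul0r big1 // => s _.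
  rewrite tensor_powE meval_pform (bigD1 i) //= /gdot big1 => [|l /eqP li].
    by rewrite expr0n muln_eq0 (gtn_eqF (hd i)) (gtn_eqF homega) mul0r mulr0.
  by rewrite (unflat_eq0 ui li) mulr0.
have := orth (tensor_pow d (unflat u)) _.
rewrite sym_pow_tensor bw_form_power; last exact: homog_combination.
rewrite (eq_veronese _ (coords_unflat u)) mevalB meval_sum => H.
have /H/subr0_eq -> : cone d (tensor_pow d (unflat u)).
  by exists 1, (unflat u); split=> //; rewrite scale1r.
by apply: eq_bigr => s _; rewrite mevalZ meval_sym_pow_tensor.
Qed.

Lemma proj_meval u : (proj omega f).@[u] = f.@[veronese d u 0].
Proof.
apply: is_proj_meval; rewrite /proj; case: xgetP => [g _ //|/= H].
by have [g /H] := is_proj_exists.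
Qed.

Lemma proj_toV : exists z : 'rV[C]_(dimV m e), proj omega f = toV z.
Proof.
have [z zE] := restriction_multihomog; exists z.
by apply: mpoly_eval_inj => u; rewrite proj_meval zE.
Qed.

End Projection.

(** * Differentials *)

Local Open Scope classical_set_scope.

Section Differential.
Variables (C : numClosedFieldType) (N : nat).
Implicit Types (P Q : {mpoly C[N]}) (y w : 'rV[C]_N).

(** Restated so that the sum lives in the ring structure of a closed field, which is
    the one that the other lemmas produce. *)
Lemma differentialE P y w :
  differential P y w = \sum_(l < N) P^`M(l).@[y 0] * w 0 l.
Proof. by []. Qed.

Lemma differentialD P Q y w :
  differential (P + Q) y w = differential P y w + differential Q y w.
Proof.
rewrite /differential -big_split; apply: eq_bigr => l _ /=.
by rewrite mderivD mevalD mulrDl.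
Qed.

Lemma differentialZ c P y w : differential (c *: P) y w = c * differential P y w.
Proof.
rewrite /differential mulr_sumr; apply: eq_bigr => l _ /=.
by rewrite mderivZ mevalZ mulrA.
Qed.

Lemma differentialB P Q y w :
  differential (P - Q) y w = differential P y w - differential Q y w.
Proof. by rewrite -scaleN1r differentialD differentialZ mulN1r. Qed.

Lemma differentialM P Q y w :
  differential (P * Q) y w =
  differential P y w * Q.@[y 0] + P.@[y 0] * differential Q y w.
Proof.
rewrite /differential mulr_suml mulr_sumr -big_split; apply: eq_bigr => l _ /=.
by rewrite mderivM mevalD !mevalM; ring.
Qed.

Lemma differentialC c y w : differential c%:MP y w = 0.
Proof. by rewrite /differential big1 // => l _; rewrite mderivC meval0 mul0r. Qed.

Lemma differential_sum (I : Type) (r : seq I) (p : pred I) (F : I -> {mpoly C[N]}) y w :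
  differential (\sum_(i <- r | p i) F i) y w = \sum_(i <- r | p i) differential (F i) y w.
Proof.
elim/big_rec2: _ => [|i a b _ <-]; last by rewrite differentialD.
by rewrite -(mpolyC0 N) differentialC.
Qed.

Lemma differentialXU l y w : differential 'X_l y w = w 0 l.
Proof.
rewrite /differential (bigD1 l) //= big1 => [|j jl].
  by rewrite mderivXU eqxx mevalC mul1r addr0.
by rewrite mderivXU eq_sym (negbTE jl) mevalC mul0r.
Qed.

Lemma differential_exp P r y w :
  differential (P ^+ r) y w = r%:R * P.@[y 0] ^+ r.-1 * differential P y w.
Proof.
rewrite /differential mulr_sumr; apply: eq_bigr => l _.
by rewrite mderiv_exp !mevalM rmorphXn /= -mpolyC_nat mevalC; ring.
Qed.

Lemma differential_comp n' (P : {mpoly C[n']}) (q : n'.-tuple {mpoly C[N]}) y w :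
  differential (P \mPo q) y w =
  \sum_(j < n') P^`M(j).@[fun i => (tnth q i).@[y 0]] * differential (tnth q j) y w.
Proof.
rewrite /differential; under eq_bigr => l _.
  rewrite mderiv_comp meval_sum mulr_suml.
  under eq_bigr do rewrite mevalM comp_mpoly_meval -mulrA.
over.
rewrite exchange_big /=; apply: eq_bigr => j _.
by rewrite mulr_sumr.
Qed.

End Differential.

(** * Equations and tangent space of the unit cone *)

Section UnitCone.
Variables (C : numClosedFieldType) (k : nat) (m d : 'I_k -> nat).
Hypothesis hd : forall i, (0 < d i)%N.
Local Notation n := (nvars m).
Local Notation N := (dimV m d).
Local Notation Y := (@unit_cone C k m d).
Local Notation dot := (@gdot C n k (@grp k m)).
Local Notation D := (\sum_(i < k) d i)%N.
Implicit Types (u p z : 'I_n -> C) (y w : 'rV[C]_N).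

Lemma dot_scale (r : 'I_k -> C) u p i :
  dot i (fun l => r (grp l) * u l) p = r i * dot i u p.
Proof.
rewrite /gdot mulr_sumr; apply: eq_bigr => l /eqP ->.
by rewrite mulrA.
Qed.

Lemma dotC u p i : dot i u p = dot i p u.
Proof. by apply: eq_bigr => l _; rewrite mulrC. Qed.

Definition unit_vector u := forall i, dot i u u = 1.

Lemma cone_veronese c u : veronese d u != 0 -> cone d (toV (c *: veronese d u)).
Proof.
move=> u0; exists c, (unflat u); split=> [i|].
  by apply: contraNneq u0 => /(veronese_eq0 hd) ->.
by rewrite tensor_pow_unflat pform_toV toVZ.
Qed.

Lemma veronese_unit_neq0 u : unit_vector u -> veronese d u != 0.
Proof.
move=> uu; apply: contraTneq (oner_neq0 C) => v0.
rewrite negbK; apply/eqP.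
transitivity (\prod_(i < k) dot i u u ^+ d i).
  by rewrite big1 // => i _; rewrite uu expr1n.
by rewrite -sum_veronese v0 big1 // => l _; rewrite !mxE mul0r.
Qed.

(** The components of a point of the cone are not isotropic, since the product of
    their squared norms is the squared norm of the point; dividing each component by a
    square root of its norm collects all scalars in a single [eps]. *)
Lemma unit_coneP y : Y y <->
  exists (eps : C) u, [/\ eps ^+ 2 = 1, unit_vector u & y = eps *: veronese d u].
Proof.
split=> [[[c [v [_ E]]]]|[eps [u [eps2 uu ->]]]].
  have {E} -> : y = c *: veronese d (coords v).
    by apply: (@toV_inj C); rewrite E tensor_powE pform_toV toVZ.
  rewrite bw_toV; set u := coords v.
  have -> : \sum_l (c *: veronese d u) 0 l * (c *: veronese d u) 0 l =
            c ^+ 2 * \prod_(i < k) dot i u u ^+ d i.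
    rewrite -sum_veronese mulr_sumr; apply: eq_bigr => l _.
    by rewrite ![fun_of_matrix (c *: _) 0 l]mxE; ring.
  move=> cE; have unz i : dot i u u != 0.
    apply: contra_eq_neq cE => ui.
    by rewrite (bigD1 i) //= ui expr0n (gtn_eqF (hd i)) mul0r mulr0 eq_sym oner_eq0.
  pose r i := sqrtC (dot i u u).
  have rnz i : r i != 0 by rewrite sqrtC_eq0.
  exists (c * \prod_(i < k) r i ^+ d i), (fun l => (r (grp l))^-1 * u l); split.
  - rewrite exprMn -prodrXl -[RHS]cE; congr (_ * _).
    by apply: eq_bigr => i _; rewrite -exprM mulnC exprM sqrtCK.
  - move=> i; rewrite (dot_scale (fun i => (r i)^-1)) dotC.
    rewrite (dot_scale (fun i => (r i)^-1)) mulrA -invfM -expr2 sqrtCK mulVf //.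
  - rewrite (veronese_gscale _ (fun i => (r i)^-1)) scalerA.
    rewrite -mulrA -big_split big1 ?mulr1 //= => i _.
    by rewrite -exprMn mulfV ?expr1n.
split; first exact/cone_veronese/veronese_unit_neq0.
rewrite bw_toV; transitivity (eps ^+ 2 * \prod_(i < k) dot i u u ^+ d i).
  rewrite -sum_veronese mulr_sumr; apply: eq_bigr => l _.
  by rewrite ![fun_of_matrix (eps *: _) 0 l]mxE; ring.
by rewrite eps2 big1 ?mulr1 // => i _; rewrite uu expr1n.
Qed.

(** Linear forms in the coordinates [y] of a form [psi = toV y]: its value at [p], and
    its partial derivative at [p] divided by the degree of the group. *)
Definition eval_at p : {mpoly C[N]} := \sum_l (bw_basis C l).@[p] *: 'X_l.
Definition partial_at p (q : 'I_n) : {mpoly C[N]} :=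
  \sum_l ((d (grp q))%:R^-1 * (bw_basis C l)^`M(q).@[p]) *: 'X_l.

Lemma meval_eval_at p y : (eval_at p).@[y 0] = (toV y).@[p].
Proof.
rewrite meval_sum meval_toV; apply: eq_bigr => l _.
by rewrite mevalZ mevalXU mulrC.
Qed.

Lemma mderiv_toV y q p :
  (toV y)^`M(q).@[p] = \sum_l y 0 l * (bw_basis C l)^`M(q).@[p].
Proof.
rewrite (linear_sum (mderiv q)) /= meval_sum; apply: eq_bigr => l _.
by rewrite mderivZ mevalZ.
Qed.

Lemma meval_partial_at p q y : (partial_at p q).@[y 0] = (d (grp q))%:R^-1 * (toV y)^`M(q).@[p].
Proof.
rewrite meval_sum mderiv_toV mulr_sumr; apply: eq_bigr => l _.
by rewrite mevalZ mevalXU; ring.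
Qed.

Lemma differential_eval_at p y w : differential (eval_at p) y w = (toV w).@[p].
Proof.
rewrite differential_sum meval_toV; apply: eq_bigr => l _.
by rewrite differentialZ differentialXU mulrC.
Qed.

Lemma differential_partial_at p q y w :
  differential (partial_at p q) y w = (d (grp q))%:R^-1 * (toV w)^`M(q).@[p].
Proof.
rewrite differential_sum mderiv_toV mulr_sumr; apply: eq_bigr => l _.
by rewrite differentialZ differentialXU; ring.
Qed.

(** If [psi] is decomposable then its gradient at a point [p] is proportional, group by
    group, to the components of the decomposition, so [psi] can be rebuilt from its
    gradient at [p].  The homogeneity factors make both sides polynomial, and the
    leading [psi(p)] on the right absorbs the points where a factor vanishes.  The
    scalar [kap] multiplies both sides by [kap ^+ D]; it is chosen as the sign of the
    point when the tangent space is computed, to make the value at [p] equal to 1. *)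
Definition segre_eq p kap (l : 'I_N) : {mpoly C[N]} :=
  (kap *: eval_at p) ^+ D * 'X_l -
  eval_at p * (bw_basis C l \mPo [tuple kap *: partial_at p q | q < n]).

Definition norm_eq : {mpoly C[N]} := \sum_l 'X_l ^+ 2 - 1%:MP.

Lemma meval_segre_eq p kap l y : (segre_eq p kap l).@[y 0] =
  (kap * (toV y).@[p]) ^+ D * y 0 l -
  (toV y).@[p] *
  veronese d (fun q => kap * ((d (grp q))%:R^-1 * (toV y)^`M(q).@[p])) 0 l.
Proof.
rewrite mevalB !mevalM rmorphXn /= mevalZ mevalXU meval_eval_at comp_mpoly_meval.
rewrite [veronese _ _ _ _]mxE; congr (_ - _ * _).
by apply: meval_eq => q; rewrite tnth_mktuple mevalZ meval_partial_at.
Qed.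

Lemma dot_mderiv_pform u p q :
  dot (grp q) u p * (pform (@grp k m) d u)^`M(q).@[p] =
  (d (grp q))%:R * u q * \prod_(i < k) dot i u p ^+ d i.
Proof.
have := congr1 (meval p) (lform_mderiv_pform (@grp k m) d u q).
by rewrite mevalM meval_lform mevalZ meval_pform.
Qed.

Lemma natr_d_neq0 i : (d i)%:R != 0 :> C.
Proof. by rewrite pnatr_eq0 -lt0n. Qed.

(** For nonzero products [u_i . p_i], the scaled gradient is [u] rescaled in each group,
    and the homogeneity of [veronese] gives the equality.  Otherwise the value at [p]
    is zero and both sides vanish. *)
Lemma segre_eq_cone p kap l c u : (segre_eq p kap l).@[(c *: veronese d u) 0] = 0.
Proof.
rewrite meval_segre_eq toVZ -pform_toV mevalZ meval_pform.
set T := \prod_(i < k) _.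
have [nz|] := pselect (forall i, dot i u p != 0); last first.
  move=> /existsNP [i /negP]; rewrite negbK => /eqP ui.
  have -> : T = 0 by rewrite /T (bigD1 i) //= ui expr0n (gtn_eqF (hd i)) mul0r.
  by rewrite !mulr0 expr0n (bigD1 i) //= addn_eq0 (gtn_eqF (hd i)) /= !mul0r subrr.
have T0 : T != 0 by apply/prodf_neq0 => i _; rewrite expf_neq0.
pose r i := kap * c * T / dot i u p.
rewrite (@eq_veronese _ _ _ _
  (fun q => kap * ((d (grp q))%:R^-1 * (c *: pform (@grp k m) d u)^`M(q).@[p]))
  (fun q => r (grp q) * u q)) => [|q]; last first.
  rewrite /= mderivZ mevalZ /r.
  apply: (mulfI (nz (grp q))).
  transitivity (kap * (d (grp q))%:R^-1 * c *
     (dot (grp q) u p * ((pform (@grp k m) d u)^`M(q)).@[p])); first by ring.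
  rewrite dot_mderiv_pform -/T.
  by have := natr_d_neq0 (grp q); have := nz (grp q) => h1 h2; field; rewrite h1 h2.
rewrite veronese_gscale.
have -> : \prod_(i < k) r i ^+ d i = (kap * c * T) ^+ D / T.
  rewrite /r; under eq_bigr do rewrite exprMn exprVn.
  by rewrite big_split /= prodrXr prodfV.
by rewrite mulrA ![fun_of_matrix (_ *: _) 0 l]mxE; field.
Qed.

Lemma meval_norm_eq y : norm_eq.@[y 0] = \sum_l y 0 l * y 0 l - 1.
Proof.
rewrite mevalB mevalC meval_sum; congr (_ - _).
by apply: eq_bigr => l _; rewrite rmorphXn /= mevalXU.
Qed.

Lemma segre_eq_vanishing p kap l : vanishing_ideal Y (segre_eq p kap l).
Proof. by move=> y /unit_coneP [eps [u [_ _ ->]]]; exact: segre_eq_cone. Qed.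

Lemma norm_eq_vanishing : vanishing_ideal Y norm_eq.
Proof. by move=> y [_]; rewrite bw_toV meval_norm_eq => ->; rewrite subrr. Qed.

(** A solution [y] of the equations has norm 1, so the form [toV y] is nonzero at some
    point [p], and the equation at [p] presents it as a decomposable form. *)
Lemma unit_cone_closed : zariski_closed Y.
Proof.
exists [set P | P = norm_eq \/ exists p l, P = segre_eq p 1 l].
apply/seteqP; split=> [y Yy P [->|[p [l ->]]]|y H].
- exact: norm_eq_vanishing.
- exact: segre_eq_vanishing.
have /eqP := H norm_eq (or_introl erefl).
rewrite meval_norm_eq subr_eq0 => /eqP y1.
have ynz : y != 0.
  apply: contra_eq_neq y1 => ->; rewrite big1 => [|l _]; last by rewrite mxE mul0r.
  by rewrite eq_sym oner_neq0.
have [p p0] : exists p, (toV y).@[p] != 0.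
  apply/not_existsP => Hp; case/eqP: ynz; apply: (@toV_inj C).
  rewrite toV0; apply: mpoly_vanish => u.
  by have /negP := Hp u; rewrite negbK => /eqP.
set G := fun q => 1 * ((d (grp q))%:R^-1 * (toV y)^`M(q).@[p]).
have yE : y = ((toV y).@[p] / (toV y).@[p] ^+ D) *: veronese d G.
  apply/rowP => l; have := H _ (or_intror (ex_intro _ p (ex_intro _ l erefl))).
  rewrite meval_segre_eq mul1r => /subr0_eq E.
  by rewrite mxE mulrAC -E mulrAC mulfV ?mul1r ?expf_neq0.
split; last by rewrite bw_toV.
rewrite yE; apply: cone_veronese; apply: contra_neq ynz => G0.
by rewrite yE G0 scaler0.
Qed.

(** The differential of [veronese] at [u] in the direction [z]. *)
Definition dveronese u z : 'rV[C]_N :=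
  \row_l \sum_q (bw_basis C l)^`M(q).@[u] * z q.

(** Differentiating [segre_eq] at [p = u] expresses a tangent vector [w] as the
    differential of [veronese] applied to the gradient at [u] of the form [toV w], divided
    in each group by its degree.  The
    norm equation says that this form vanishes at [u], and then Euler's identity says
    that its gradient is orthogonal to [u]. *)
Lemma tangent_sub eps u w : eps ^+ 2 = 1 -> unit_vector u ->
  tangent_space Y (eps *: veronese d u) w ->
  exists z, (forall i, dot i u z = 0) /\ w = dveronese u z.
Proof.
move=> eps2 uu; set y := eps *: _ => Tw.
have eps0 : eps != 0 by apply: contra_eq_neq eps2 => ->; rewrite expr0n eq_sym oner_neq0.
have T1 : \prod_(i < k) dot i u u ^+ d i = 1 by rewrite big1 // => i _; rewrite uu expr1n.
have yu : (toV y).@[u] = eps by rewrite toVZ mevalZ -pform_toV meval_pform T1 mulr1.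
have dyu q : (d (grp q))%:R^-1 * (toV y)^`M(q).@[u] = eps * u q.
  have := dot_mderiv_pform u u q; rewrite uu T1 mul1r mulr1 => E.
  by rewrite toVZ mderivZ mevalZ -pform_toV E; field; rewrite natr_d_neq0.
have wu : (toV w).@[u] = 0.
  have := Tw _ norm_eq_vanishing; rewrite differentialB differentialC subr0.
  rewrite differential_sum => E.
  have : 2 * eps * (toV w).@[u] = 0.
    rewrite -E meval_toV mulr_sumr; apply: eq_bigr => l _.
    rewrite differential_exp differentialXU mevalXU /= expr1 [y 0 l]mxE [veronese d u 0 l]mxE.
    by ring.
  by move/eqP; rewrite !mulf_eq0 pnatr_eq0 (negbTE eps0) /= => /eqP.
exists (fun q => (d (grp q))%:R^-1 * (toV w)^`M(q).@[u]); split=> [i|].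
  transitivity ((d i)%:R^-1 * \sum_(q | grp q == i) u q * (toV w)^`M(q).@[u]).
    by rewrite mulr_sumr; apply: eq_bigr => q /eqP ->; ring.
  by rewrite euler_toV wu !mulr0.
apply/rowP => l; rewrite mxE; apply/eqP; rewrite -subr_eq0; apply/eqP.
have := Tw _ (segre_eq_vanishing u eps l); rewrite /segre_eq differentialB.
rewrite !differentialM differential_exp differentialXU !rmorphXn /= !differentialZ !mevalZ.
rewrite !differential_eval_at meval_eval_at yu wu !(mulr0, mul0r) !add0r -expr2 eps2 expr1n mul1r.
rewrite differential_comp => E; rewrite -[RHS]E; congr (_ - _).
rewrite mulr_sumr; apply: eq_bigr => q _.
rewrite tnth_mktuple differentialZ differential_partial_at.
rewrite (@meval_eq _ _ _ u) => [|j]; last first.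
  by rewrite tnth_mktuple mevalZ meval_partial_at dyu mulrA -expr2 eps2 mul1r.
rewrite -[LHS]mul1r -eps2; ring.
Qed.

End UnitCone.

(** * Closures of rational images *)

Section RationalImage.
Variables (C : numClosedFieldType) (N n : nat).
Variables (num : 'I_N -> {mpoly C[n]}) (den : {mpoly C[n]}).
Implicit Types (P : {mpoly C[N]}) (t : 'I_n -> C).

Definition rational_point t : 'rV[C]_N := \row_l ((num l).@[t] / den.@[t]).
Definition rational_image : set 'rV[C]_N :=
  [set y | exists t, den.@[t] != 0 /\ y = rational_point t].

(** At a point where the denominator equals 1 to first order, clearing denominators does
    not affect first derivatives, so they are given by the chain rule applied to the
    numerators alone. *)
Lemma clear_denominators P : exists K (Q : {mpoly C[n]}),
  (forall t, den.@[t] != 0 ->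
     Q.@[t] = den.@[t] ^+ K * P.@[fun l => (num l).@[t] / den.@[t]]) /\
  (forall t j, den.@[t] = 1 -> den^`M(j).@[t] = 0 ->
     Q^`M(j).@[t] =
     \sum_(l < N) P^`M(l).@[fun l => (num l).@[t]] * (num l)^`M(j).@[t]).
Proof.
have value_at_base Q K P' t : den.@[t] = 1 ->
    (forall t, den.@[t] != 0 ->
       Q.@[t] = den.@[t] ^+ K * P'.@[fun l => (num l).@[t] / den.@[t]]) ->
    Q.@[t] = P'.@[fun l => (num l).@[t]].
  move=> d1 ->; rewrite d1 ?oner_neq0 // expr1n mul1r.
  by apply: meval_eq => l; rewrite divr1.
elim/mpoly_ring_ind: P => [c|i|p q [K1 [Q1 [e1 d1]]] [K2 [Q2 [e2 d2]]]
                               |p q [K1 [Q1 [e1 d1]]] [K2 [Q2 [e2 d2]]]].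
- exists 0%N, c%:MP; split=> [t _|t j _ _]; first by rewrite !mevalC mul1r.
  by rewrite mderivC meval0 big1 // => l _; rewrite mderivC meval0 mul0r.
- exists 1%N, (num i); split=> [t t0|t j _ _].
    by rewrite mevalXU expr1 mulrC divfK.
  rewrite (bigD1 i) //= big1 ?addr0 => [|l li].
    by rewrite mderivXU eqxx mevalC mul1r.
  by rewrite mderivXU eq_sym (negbTE li) mevalC mul0r.
- exists (K1 + K2)%N, (Q1 * den ^+ K2 + Q2 * den ^+ K1); split=> [t t0|t j t1 dt].
    by rewrite !mevalD !mevalM !rmorphXn /= e1 // e2 // exprD; ring.
  rewrite mderivD !mderivM !mderiv_exp !(mevalD, mevalM) dt !mulr0 !addr0.
  rewrite !rmorphXn /= t1 !expr1n !mulr1 d1 // d2 // -big_split /=.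
  by apply: eq_bigr => l _; rewrite mderivD mevalD mulrDl.
- exists (K1 + K2)%N, (Q1 * Q2); split=> [t t0|t j t1 dt].
    by rewrite !mevalM e1 // e2 // exprD; ring.
  rewrite mderivM mevalD !mevalM d1 // d2 //.
  rewrite (value_at_base _ _ _ _ t1 e1) (value_at_base _ _ _ _ t1 e2).
  rewrite mulr_suml mulr_sumr -big_split /=; apply: eq_bigr => l _.
  by rewrite mderivM mevalD !mevalM; ring.
Qed.

Hypothesis den0 : den != 0.

Lemma mpoly_vanish_off (Q : {mpoly C[n]}) :
  (forall t, den.@[t] != 0 -> Q.@[t] = 0) -> Q = 0.
Proof.
move=> Q0; apply/eqP; have : Q * den == 0.
  apply/eqP/mpoly_vanish => t; rewrite mevalM.
  by have [->|/Q0 ->] := eqVneq den.@[t] 0; rewrite ?mulr0 ?mul0r.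
by rewrite mulf_eq0 (negbTE den0) orbF.
Qed.

Lemma meval_row P t :
  P.@[rational_point t 0] = P.@[fun l => (num l).@[t] / den.@[t]].
Proof. by apply: meval_eq => l; rewrite mxE. Qed.

(** Pulling back to the parameter space and clearing denominators embeds the functions
    on the image into fractions of a polynomial ring, which is a domain. *)
Lemma rational_image_prime P1 P2 :
  vanishing_ideal rational_image (P1 * P2) ->
  vanishing_ideal rational_image P1 \/ vanishing_ideal rational_image P2.
Proof.
move=> P120.
have [K1 [Q1 [e1 _]]] := clear_denominators P1.
have [K2 [Q2 [e2 _]]] := clear_denominators P2.
have : Q1 * Q2 == 0.
  apply/eqP/mpoly_vanish_off => t t0; rewrite mevalM e1 // e2 //.
  have := P120 (rational_point t); rewrite meval_row mevalM => E.
  by rewrite mulrACA E ?mulr0 //; exists t.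
have aux P Q K : (forall t, den.@[t] != 0 ->
    Q.@[t] = den.@[t] ^+ K * P.@[fun l => (num l).@[t] / den.@[t]]) -> Q = 0 ->
    vanishing_ideal rational_image P.
  move=> e Q0 _ [t [t0 ->]]; rewrite meval_row; apply/eqP.
  by have /eqP := e t t0; rewrite Q0 meval0 eq_sym mulf_eq0 expf_eq0 (negbTE t0) andbF.
by rewrite mulf_eq0 => /orP[] /eqP; [left|right]; apply: aux; eassumption.
Qed.

Definition zariski_closure (Z : set 'rV[C]_N) := zero_locus (vanishing_ideal Z).

Lemma sub_zariski_closure Z : Z `<=` zariski_closure Z.
Proof. by move=> y Zy P; apply. Qed.

Lemma zariski_closure_min Z Y : Z `<=` Y -> zariski_closed Y -> zariski_closure Z `<=` Y.
Proof. by move=> ZY [E YE]; rewrite YE => y yZ P EP; apply: yZ => z /ZY; rewrite YE; apply. Qed.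

Lemma zariski_closureS Z Z' : Z `<=` Z' -> zariski_closure Z `<=` zariski_closure Z'.
Proof. by move=> ZZ y yZ P P0; apply: yZ => z /ZZ; apply: P0. Qed.

Lemma rational_image_irreducible : irreducible_closed (zariski_closure rational_image).
Proof.
split; first by exists (vanishing_ideal rational_image).
  have [t t0] : exists t, den.@[t] != 0.
    apply/not_existsP => H; case/eqP: den0; apply: mpoly_vanish => t.
    by have /negP := H t; rewrite negbK => /eqP.
  by exists (rational_point t); apply: sub_zariski_closure; exists t.
move=> Z1 Z2 [E1 ->] [E2 ->] Z12.
apply: contrapT => /not_orP [nZ1 nZ2].
have wit E : ~ zariski_closure rational_image `<=` zero_locus E ->
    exists2 P, E P & ~ vanishing_ideal rational_image P.
  move=> nE; apply: contrapT => H; apply: nE => z zZ P EP; apply: zZ.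
  by apply: contrapT => nP; apply: H; exists P.
have [P1 EP1 nP1] := wit _ nZ1; have [P2 EP2 nP2] := wit _ nZ2.
have [] // : vanishing_ideal rational_image P1 \/ vanishing_ideal rational_image P2.
apply: rational_image_prime => y /sub_zariski_closure /Z12 [] yE; rewrite mevalM.
  by rewrite (yE _ EP1) mul0r.
by rewrite (yE _ EP2) mulr0.
Qed.

Lemma rational_image_tangent P t j :
  vanishing_ideal rational_image P -> den.@[t] = 1 -> den^`M(j).@[t] = 0 ->
  \sum_(l < N) P^`M(l).@[fun l => (num l).@[t]] * (num l)^`M(j).@[t] = 0.
Proof.
move=> P0 t1 dt; have [K [Q [e dd]]] := clear_denominators P.
rewrite -dd // (_ : Q = 0) ?mderiv0 ?meval0 //.
apply: mpoly_vanish_off => s s0; rewrite e // -meval_row P0 ?mulr0 //.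
by exists s.
Qed.

End RationalImage.

(** * Stereographic parametrization of the product of spheres *)

Section SphereParametrization.
Variables (C : numClosedFieldType) (k : nat) (m d : 'I_k -> nat).
Hypothesis hd : forall i, (0 < d i)%N.
Local Notation n := (nvars m).
Local Notation N := (dimV m d).
Local Notation Y := (@unit_cone C k m d).
Local Notation dot := (@gdot C n k (@grp k m)).
Variables (eps : C) (u : 'I_n -> C).
Hypotheses (eps2 : eps ^+ 2 = 1) (uu : unit_vector u).
Implicit Types (w z : 'I_n -> C).

(** Inverse stereographic projection: the line from [- u_i] through [w_i], with [w_i]
    orthogonal to [u_i], meets the sphere again at
    [((1 - w_i.w_i) u_i + 2 w_i) / (1 + w_i.w_i)].  It is written with the denominator
    [D = 1 + w_i.w_i], so that the coefficient of [u_i] is [2 - D]. *)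
Definition stereo_den w i : C := 1 + dot i w w.
Definition stereo_num w p : C := (2 - stereo_den w (grp p)) * u p + 2 * w p.
Definition stereo_point w p : C := (stereo_den w (grp p))^-1 * stereo_num w p.

Definition orthogonal_to z w := forall i, dot i z w = 0.

Lemma dot_stereo_num w i : orthogonal_to u w -> dot i u (stereo_num w) = 2 - stereo_den w i.
Proof.
move=> uw; transitivity ((2 - stereo_den w i) * dot i u u + 2 * dot i u w).
  rewrite /gdot !mulr_sumr -big_split; apply: eq_bigr => l /eqP li /=.
  by rewrite /stereo_num li; ring.
by rewrite uu uw mulr1 mulr0 addr0.
Qed.

Lemma dot_stereo_num_stereo_num w i : orthogonal_to u w ->
  dot i (stereo_num w) (stereo_num w) = stereo_den w i ^+ 2.
Proof.
move=> uw.
transitivity ((2 - stereo_den w i) ^+ 2 * dot i u u + 4 * (2 - stereo_den w i) * dot i u w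
              + 4 * dot i w w).
  rewrite /gdot !mulr_sumr -!big_split; apply: eq_bigr => l /eqP li /=.
  by rewrite /stereo_num li; ring.
by rewrite uu uw (_ : dot i w w = stereo_den w i - 1) /stereo_den; ring.
Qed.

Lemma dot_stereo_point w i : orthogonal_to u w ->
  dot i u (stereo_point w) = (stereo_den w i)^-1 * (2 - stereo_den w i).
Proof.
move=> uw; rewrite -(dot_stereo_num i uw) dotC (dot_scale (fun i => (stereo_den w i)^-1)).
by rewrite dotC.
Qed.

Lemma stereo_point_unit w : orthogonal_to u w -> (forall i, stereo_den w i != 0) ->
  unit_vector (stereo_point w).
Proof.
move=> uw w0 i; rewrite (dot_scale (fun i => (stereo_den w i)^-1)) dotC.
rewrite (dot_scale (fun i => (stereo_den w i)^-1)) dot_stereo_num_stereo_num //.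
by have := w0 i; move=> h; field.
Qed.

Definition sphere_image (S : set ('I_n -> C)) : set 'rV[C]_N :=
  [set y | exists w, [/\ S w, forall i, stereo_den w i != 0 &
                         y = eps *: veronese d (stereo_point w)]].

Lemma sphere_image_sub S : (forall w, S w -> orthogonal_to u w) ->
  sphere_image S `<=` Y.
Proof.
move=> So y [w [Sw w0 ->]]; apply/(unit_coneP hd); exists eps, (stereo_point w).
by split=> //; apply: stereo_point_unit => //; apply: So.
Qed.

(* [W] parametrizes the vectors [w] polynomially; the denominator and numerators below *)
(* present [sphere_image] of its range as a rational image. *)
Variables (n' : nat) (W : 'I_n -> {mpoly C[n']}).
Local Notation Wt := (fun t p => (W p).@[t]).

Definition pden i : {mpoly C[n']} := 1%:MP + \sum_(p | grp p == i) W p ^+ 2.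
Definition pnum p : {mpoly C[n']} :=
  (2%:MP - pden (grp p)) * (u p)%:MP + 2%:MP * W p.
Definition sphere_den : {mpoly C[n']} := \prod_(i < k) pden i ^+ d i.
Definition sphere_num (l : 'I_N) : {mpoly C[n']} :=
  eps *: (bw_basis C l \mPo [tuple pnum p | p < n]).

Lemma meval_pden i t : (pden i).@[t] = stereo_den (Wt t) i.
Proof.
rewrite mevalD mevalC meval_sum; congr (1 + _).
by apply: eq_bigr => p _; rewrite rmorphXn.
Qed.

Lemma meval_pnum p t : (pnum p).@[t] = stereo_num (Wt t) p.
Proof. by rewrite mevalD !mevalM mevalB !mevalC meval_pden. Qed.

Lemma sphere_den_neq0 t : (sphere_den.@[t] != 0) = [forall i, stereo_den (Wt t) i != 0].
Proof.
rewrite rmorph_prod /=; under eq_bigr do rewrite rmorphXn /= meval_pden.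
apply/idP/forallP => [/prodf_neq0 H i|H]; last by apply/prodf_neq0 => i _; rewrite expf_neq0.
by have := H i isT; rewrite expf_eq0 hd.
Qed.

Lemma sphere_rational_point t : sphere_den.@[t] != 0 ->
  rational_point (N := N) sphere_num sphere_den t = eps *: veronese d (stereo_point (Wt t)).
Proof.
move=> t0; rewrite (veronese_gscale _ (fun i => (stereo_den (Wt t) i)^-1)).
have -> : \prod_(i < k) (stereo_den (Wt t) i)^-1 ^+ d i = sphere_den.@[t]^-1.
  rewrite rmorph_prod /= -prodfV; apply: eq_bigr => i _.
  by rewrite exprVn rmorphXn /= meval_pden.
apply/rowP => l; rewrite !mxE mevalZ comp_mpoly_meval.
have -> : (bw_basis C l).@[fun p => (tnth [tuple pnum p | p < n] p).@[t]] =
          (bw_basis C l).@[stereo_num (Wt t)].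
  by apply: meval_eq => p; rewrite tnth_mktuple meval_pnum.
by ring.
Qed.

Lemma rational_sphere_image :
  rational_image (N := N) sphere_num sphere_den = sphere_image (range Wt).
Proof.
apply/seteqP; split=> [y [t [t0 ->]]|y [_ [[t _ <-] w0 ->]]].
  exists (Wt t); split; [by exists t| |exact: sphere_rational_point].
  by apply/forallP; rewrite -sphere_den_neq0.
have t0 : sphere_den.@[t] != 0 by rewrite sphere_den_neq0; apply/forallP.
by exists t; rewrite sphere_rational_point.
Qed.

Variable t0 : 'I_n' -> C.
Hypothesis Wt0 : forall p, (W p).@[t0] = 0.

Lemma pden_base i : (pden i).@[t0] = 1.
Proof.
by rewrite meval_pden /stereo_den /gdot big1 ?addr0 // => p _; rewrite Wt0 mulr0.
Qed.

Lemma mderiv_pden_base i j : (pden i)^`M(j).@[t0] = 0.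
Proof.
rewrite mderivD mderivC add0r (linear_sum (mderiv j)) /= meval_sum big1 // => p _.
by rewrite mderiv_exp /= expr1 !mevalM Wt0 mulr0 mul0r.
Qed.

Lemma sphere_den_base : sphere_den.@[t0] = 1.
Proof.
by rewrite rmorph_prod big1 //= => i _; rewrite rmorphXn /= pden_base expr1n.
Qed.

Lemma mderiv_sphere_den_base j : sphere_den^`M(j).@[t0] = 0.
Proof.
suff [] : sphere_den.@[t0] = 1 /\ sphere_den^`M(j).@[t0] = 0 by [].
apply: (big_ind (fun q : {mpoly C[n']} => q.@[t0] = 1 /\ q^`M(j).@[t0] = 0)).
- by rewrite -(mpolyC1 n') mevalC mderivC meval0.
- move=> p q [p1 dp] [q1 dq].
  by rewrite mderivM mevalD !mevalM dp dq p1 q1 mulr1 mulr0 mul0r addr0.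
- move=> i _; rewrite mderiv_exp !mevalM mderiv_pden_base mulr0.
  by rewrite rmorphXn /= pden_base expr1n.
Qed.

Lemma sphere_den_poly_neq0 : sphere_den != 0.
Proof.
by apply: contraTneq (oner_neq0 C) => E; rewrite -sphere_den_base E meval0 eqxx.
Qed.

Lemma pnum_base p : (pnum p).@[t0] = u p.
Proof.
rewrite meval_pnum /stereo_num -meval_pden pden_base Wt0 mulr0 addr0.
by ring.
Qed.

Lemma mderiv_pnum_base p j : (pnum p)^`M(j).@[t0] = 2 * (W p)^`M(j).@[t0].
Proof.
rewrite mderivD !mderivM mderivB !mderivC !(mevalD, mevalM, mevalN, mevalC, meval0).
by rewrite mderiv_pden_base; ring.
Qed.

Lemma sphere_num_base l : (sphere_num l).@[t0] = (eps *: veronese d u) 0 l.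
Proof.
rewrite !mxE mevalZ comp_mpoly_meval; congr (_ * _).
by apply: meval_eq => p; rewrite tnth_mktuple pnum_base.
Qed.

Lemma mderiv_sphere_num_base l j : (sphere_num l)^`M(j).@[t0] =
  2 * eps * dveronese d u (fun p => (W p)^`M(j).@[t0]) 0 l.
Proof.
rewrite mderivZ mevalZ mderiv_comp meval_sum mxE !mulr_sumr; apply: eq_bigr => p _.
rewrite mevalM comp_mpoly_meval tnth_mktuple mderiv_pnum_base.
rewrite (@meval_eq _ _ _ u) => [|q]; last by rewrite tnth_mktuple pnum_base.
by ring.
Qed.

Lemma sphere_image_irreducible : irreducible_closed (zariski_closure (sphere_image (range Wt))).
Proof.
rewrite -rational_sphere_image.
exact/rational_image_irreducible/sphere_den_poly_neq0.
Qed.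

(** The terms of the denominator other than 1 are at least quadratic in the [W p], which
    vanish at [t0]; so to first order the point moves as the numerator does, and [stereo_num]
    moves by twice [W]. *)
Lemma sphere_image_tangent P j : vanishing_ideal (sphere_image (range Wt)) P ->
  differential P (eps *: veronese d u) (dveronese d u (fun p => (W p)^`M(j).@[t0])) = 0.
Proof.
rewrite -rational_sphere_image => /rational_image_tangent H.
have := H sphere_den_poly_neq0 t0 j sphere_den_base (mderiv_sphere_den_base j).
rewrite (eq_bigr (fun l => 2 * eps * (P^`M(l).@[(eps *: veronese d u) 0] *
    dveronese d u (fun p => (W p)^`M(j).@[t0]) 0 l))) => [|l _].
  rewrite -mulr_sumr => /eqP; rewrite !mulf_eq0 pnatr_eq0 /=.
  case/orP=> [/eqP e0|/eqP //].
  by move: eps2; rewrite e0 expr0n => /eqP; rewrite eq_sym oner_eq0.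
rewrite mderiv_sphere_num_base (meval_eq _ sphere_num_base).
by ring.
Qed.

End SphereParametrization.

(** * The tangent space at a point of the unit cone *)

Section Smoothness.
Variables (C : numClosedFieldType) (k : nat) (m d : 'I_k -> nat).
Hypothesis hd : forall i, (0 < d i)%N.
Local Notation n := (nvars m).
Local Notation N := (dimV m d).
Local Notation Y := (@unit_cone C k m d).
Local Notation dot := (@gdot C n k (@grp k m)).
Variables (eps : C) (u : 'I_n -> C).
Hypotheses (eps2 : eps ^+ 2 = 1) (uu : unit_vector u).
Implicit Types (w z : 'I_n -> C).

(** The curve is the stereographic image of the line through 0 in the direction [z]; a
    sphere of dimension 1 contains no nonconstant polynomial curve, hence the detour
    through rational images. *)
Lemma tangent_sup z : orthogonal_to u z ->
  tangent_space Y (eps *: veronese d u) (dveronese d u z).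
Proof.
move=> uz P PY; pose W p : {mpoly C[1]} := z p *: 'X_ord0.
have -> : dveronese d u z = dveronese d u (fun p => (W p)^`M(ord0).@[fun=> 0]).
  apply/rowP => l; rewrite !mxE; apply: eq_bigr => p _; congr (_ * _).
  by rewrite mderivZ mderivXU eqxx mevalZ mevalC mulr1.
apply: (sphere_image_tangent hd eps2) => [p|y].
  by rewrite mevalZ mevalXU mulr0.
move/(sphere_image_sub hd eps2 uu) => yY; apply: PY; apply: yY => w [t _ <-] i.
transitivity (dot i u z * t ord0); last by rewrite uz mul0r.
by rewrite /gdot mulr_suml; apply: eq_bigr => l _; rewrite mevalZ mevalXU mulrA.
Qed.

(** Up to the factor [prod_i (u_i . x_i)^(d_i) / (u_i . x_i)], this linear form reads off
    from [veronese x] the [l]-th coordinate of the component of [x] orthogonal to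
    [u].  It thus inverts the differential of [veronese] at [u], and it distinguishes the
    members of the chain constructed below. *)
Definition chart l : {mpoly C[N]} := partial_at d u l - u l *: eval_at d u.

Lemma chart_veronese l x :
  dot (grp l) u x * (chart l).@[veronese d x 0] =
  (\prod_(i < k) dot i u x ^+ d i) * (x l - u l * dot (grp l) u x).
Proof.
rewrite mevalB mevalZ meval_partial_at meval_eval_at -pform_toV meval_pform.
have := dot_mderiv_pform d x u l; rewrite (dotC x u (grp l)) => E.
under [X in _ * (_ - _ * X)]eq_bigr do rewrite dotC.
rewrite mulrBr mulrCA E (eq_bigr (fun i => dot i u x ^+ d i)) => [|i _]; last by rewrite dotC.
by field; rewrite natr_d_neq0.
Qed.

(** Differentiate the identity of [chart_veronese] at [x = u], where the factor equals 1 and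
    the projected coordinate vanishes. *)
Lemma chart_dveronese l z : orthogonal_to u z ->
  differential (chart l) (veronese d u) (dveronese d u z) = z l.
Proof.
move=> uz; set F := chart l; set i := grp l.
pose G := F \mPo [tuple bw_basis C r | r < N].
have GE x : G.@[x] = F.@[veronese d x 0].
  rewrite comp_mpoly_meval; apply: meval_eq => r.
  by rewrite tnth_mktuple mxE.
have T1 : \prod_(i < k) dot i u u ^+ d i = 1.
  by rewrite big1 // => j _; rewrite uu expr1n.
have G0 : G.@[u] = 0.
  by have := chart_veronese l u; rewrite uu T1 mulr1 subrr mulr0 mul1r GE.
have E : lform (@grp k m) u i * G = pform (@grp k m) d u * ('X_l - u l *: lform (@grp k m) u i).
  apply: mpoly_eval_inj => x; rewrite !mevalM mevalB mevalZ mevalXU meval_lform meval_pform GE.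
  exact: chart_veronese.
have dG j : G^`M(j).@[u] = (l == j)%:R - u l * ((grp j == i)%:R * u j).
  have := congr1 (fun p => p^`M(j).@[u]) E.
  rewrite !mderivM !mevalD !mevalM mevalB mevalZ mevalXU meval_lform meval_pform.
  rewrite G0 uu T1 mulr1 subrr !mulr0 !add0r !mul1r => ->.
  by rewrite mderivB mevalB mderivZ mevalZ mderivXU mderiv_lform !mevalC.
transitivity (\sum_j G^`M(j).@[u] * z j).
  under [RHS]eq_bigr => j _.
    rewrite mderiv_comp meval_sum mulr_suml.
    under eq_bigr => r _ do rewrite mevalM comp_mpoly_meval tnth_mktuple.
  over.
  rewrite exchange_big differentialE /=; apply: eq_bigr => r _.
  rewrite mxE mulr_sumr.
  have -> : (fun s => (tnth [tuple bw_basis C r0 | r0 < N] s).@[u]) = veronese d u 0.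
    by apply/funext => s; rewrite tnth_mktuple mxE.
  by apply: eq_bigr => j _; rewrite mulrA.
under eq_bigr do rewrite dG mulrBl.
rewrite sumrB (bigD1 l) //= eqxx mul1r big1 ?addr0 => [|j jl]; last first.
  by rewrite eq_sym (negbTE jl) mul0r.
suff -> : \sum_j u l * ((grp j == i)%:R * u j) * z j = u l * dot i u z.
  by rewrite uz mulr0 subr0.
rewrite /gdot mulr_sumr [RHS]big_mkcond /=; apply: eq_bigr => j _.
by case: (grp j == i); rewrite ?mul1r ?mul0r ?mulr0 ?mulrA ?mul0r.
Qed.

(* In each group choose a coordinate [b i] at which [u] does not vanish: the equation *)
(* [u_i . z_i = 0] determines [z (b i)] from the other coordinates, which are free. *)
Variable b : 'I_k -> 'I_n.
Hypotheses (gb : forall i, grp (b i) = i) (ub : forall i, u (b i) != 0).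

Definition nonbase : seq 'I_n := [seq l <- enum 'I_n | l != b (grp l)].

Lemma mem_nonbase l : (l \in nonbase) = (l != b (grp l)).
Proof. by rewrite mem_filter mem_enum andbT. Qed.

Lemma nonbase_uniq : uniq nonbase.
Proof. by rewrite filter_uniq ?enum_uniq. Qed.

(** The vector orthogonal to [u] whose only nonzero free coordinate is the [l]-th,
    equal to 1. *)
Definition orth_basis l p : C :=
  if p == l then 1 else if p == b (grp l) then - (u l / u (b (grp l))) else 0.

Lemma orth_basis_nonbase l p : p \in nonbase -> orth_basis l p = (p == l)%:R.
Proof.
rewrite mem_nonbase /orth_basis => pb; case: (p =P l) => // _.
case: eqP => // pE; move: pb; rewrite pE gb eqxx.
by [].
Qed.

Lemma orth_basis_orth l : l \in nonbase -> orthogonal_to u (orth_basis l).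
Proof.
rewrite mem_nonbase => lb i; rewrite /gdot.
have [li|li] := eqVneq (grp l) i; last first.
  rewrite big1 // => p /eqP pi; rewrite /orth_basis.
  case: eqP => [pl|_]; first by rewrite -pi pl eqxx in li.
  case: eqP => [pl|_]; last by rewrite mulr0.
  by rewrite -pi pl gb eqxx in li.
rewrite (bigD1 l) ?li //= (bigD1 (b i)) /=; last by rewrite gb eqxx eq_sym -li.
rewrite big1 ?addr0 => [|p /andP[/andP[_ pl] pb]].
  have bl : (b i == l) = false by rewrite eq_sym -li (negbTE lb).
  rewrite /orth_basis bl eqxx mulr1 li eqxx.
  by have := ub i; move=> h; field.
by rewrite /orth_basis (negbTE pl) li (negbTE pb) mulr0.
Qed.

Lemma orth_expand z p : orthogonal_to u z ->
  z p = \sum_(l <- nonbase) z l * orth_basis l p.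
Proof.
move=> uz; have [pnb|] := boolP (p \in nonbase).
  rewrite (bigD1_seq p pnb nonbase_uniq) /= big1_seq ?addr0 => [|l /andP[lp _]].
    by rewrite orth_basis_nonbase // eqxx mulr1.
  by rewrite orth_basis_nonbase // eq_sym (negbTE lp) mulr0.
rewrite mem_nonbase negbK => /eqP pb.
rewrite big_filter big_enum_cond /=.
have up : u p != 0 by rewrite pb.
apply: (mulfI up); rewrite mulr_sumr.
have /eqP := uz (grp p); rewrite /gdot (bigD1 p) //= addr_eq0 => /eqP ->.
rewrite -sumrN [LHS]big_mkcond [RHS]big_mkcond /=; apply: eq_bigr => l _.
have [lp|lp] := eqVneq l p; first by rewrite andbF lp -pb eqxx.
rewrite andbT /orth_basis eq_sym [p == l]eq_sym (negbTE lp).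
have [gl|gl] := eqVneq (grp p) (grp l).
  by rewrite -gl -pb lp eqxx; field.
case: ifP => // _; case: eqP => [pE|_]; last by rewrite !mulr0.
by rewrite pE gb eqxx in gl.
Qed.

Lemma dveronese_sum (I : Type) (s : seq I) (c : I -> C) (z : I -> 'I_n -> C) (z' : 'I_n -> C) :
  (forall p, z' p = \sum_(i <- s) c i * z i p) ->
  dveronese d u z' = \sum_(i <- s) c i *: dveronese d u (z i).
Proof.
move=> zE; apply/rowP => r; rewrite summxE mxE.
under eq_bigr do rewrite zE mulr_sumr.
rewrite exchange_big /=; apply: eq_bigr => i _.
by rewrite !mxE mulr_sumr; apply: eq_bigr => p _; rewrite mulrCA.
Qed.

(** The images of the vectors [orth_basis l] span by [tangent_sub], and the linear forms
    [chart l] show that they are independent. *)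
Lemma unit_cone_tangent_dim :
  tangent_dim Y (eps *: veronese d u) (size nonbase).
Proof.
pose B := fun i : 'I_(size nonbase) => orth_basis (tnth (in_tuple nonbase) i).
have Bnb i : tnth (in_tuple nonbase) i \in nonbase by exact: mem_tnth.
pose X := [tuple dveronese d u (B i) | i < size nonbase].
have comb_orth c : orthogonal_to u (fun p => \sum_i c i * B i p).
  move=> i; rewrite /gdot; under eq_bigr do rewrite mulr_sumr.
  rewrite exchange_big big1 //= => j _.
  transitivity (c j * dot i u (B j)); last by rewrite orth_basis_orth ?mulr0.
  by rewrite /gdot mulr_sumr; apply: eq_bigr => l _; rewrite mulrCA.
exists <<X>>%VS; split=> [w|]; last first.
  suff /eqP -> : free X by rewrite size_tuple.
  apply/freeP => c c0 i.
  have := chart_dveronese (tnth (in_tuple nonbase) i) (comb_orth c).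
  rewrite (dveronese_sum (s := index_enum _) (c := c) (z := B)) //.
  rewrite (eq_bigr (fun i => c i *: X`_i)) => [|j _]; last first.
    by rewrite -tnth_nth tnth_mktuple.
  rewrite c0 /differential big1 => [|j _]; last by rewrite mxE mulr0.
  rewrite (bigD1 i) //= big1 ?addr0 => [|j ji].
    by rewrite /B orth_basis_nonbase // eqxx mulr1.
  rewrite /B orth_basis_nonbase // (inj_eq (tuple_uniqP (in_tuple nonbase) nonbase_uniq)).
  by rewrite eq_sym (negbTE ji) mulr0.
split=> [/coord_span ->|].
  rewrite (eq_bigr (fun i => coord X i w *: dveronese d u (B i))) => [|i _]; last first.
    by rewrite -tnth_nth tnth_mktuple.
  rewrite -(dveronese_sum (z' := fun p => \sum_i coord X i w * B i p)) //.
  exact: tangent_sup.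
case/(tangent_sub hd eps2 uu) => z [uz ->].
rewrite (dveronese_sum (s := nonbase) (c := z) (z := orth_basis)); last first.
  by move=> p; apply: orth_expand.
rewrite big_tnth; apply: memv_suml => i _; apply/memvZ/memv_span.
by apply/tnthP; exists i; rewrite tnth_mktuple.
Qed.

End Smoothness.

(** * A chain of maximal length through a point *)

Section ChainThroughPoint.
Variables (C : numClosedFieldType) (k : nat) (m d : 'I_k -> nat).
Hypothesis hd : forall i, (0 < d i)%N.
Local Notation n := (nvars m).
Local Notation N := (dimV m d).
Local Notation Y := (@unit_cone C k m d).
Local Notation dot := (@gdot C n k (@grp k m)).
Variables (eps : C) (u : 'I_n -> C).
Hypotheses (eps2 : eps ^+ 2 = 1) (uu : unit_vector u).
Variable b : 'I_k -> 'I_n.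
Hypotheses (gb : forall i, grp (b i) = i) (ub : forall i, u (b i) != 0).
Implicit Types (w z : 'I_n -> C) (A : seq 'I_n).
Local Notation nb := (nonbase b).
Local Notation B := (orth_basis u b).
Local Notation image := (@sphere_image C k m d eps u).

Definition partial_span A : 'I_n -> {mpoly C[n]} :=
  fun p => \sum_(l <- A) B l p *: 'X_l.
Definition span_set A := range (fun (t : 'I_n -> C) p => (partial_span A p).@[t]).
Definition partial_sphere A := zariski_closure (image (span_set A)).

Lemma meval_partial_span A p (t : 'I_n -> C) :
  (partial_span A p).@[t] = \sum_(l <- A) t l * B l p.
Proof.
rewrite meval_sum; apply: eq_bigr => l _.
by rewrite mevalZ mevalXU mulrC.
Qed.

Lemma span_set_orth A w : {subset A <= nb} -> span_set A w -> orthogonal_to u w.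
Proof.
move=> Anb [t _ <-] i; rewrite /gdot.
under eq_bigr do rewrite meval_partial_span mulr_sumr.
rewrite exchange_big big1_seq //= => l lA.
transitivity (t l * dot i u (B l)); last by rewrite orth_basis_orth ?mulr0 ?Anb.
by rewrite /gdot mulr_sumr; apply: eq_bigr => p _; rewrite mulrCA.
Qed.

Lemma span_set_out A w l : {subset A <= nb} -> l \in nb -> l \notin A ->
  span_set A w -> w l = 0.
Proof.
move=> Anb lnb lA [t _ <-]; rewrite meval_partial_span big1_seq // => j jA.
rewrite orth_basis_nonbase //; case: eqP => [lj|_]; last by rewrite mulr0.
by move: jA; rewrite /= -lj (negbTE lA).
Qed.

Lemma span_setS A l : l \notin A -> span_set A `<=` span_set (rcons A l).
Proof.
move=> lA _ [t _ <-]; exists (fun j => if j == l then 0 else t j) => //.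
apply/funext => p; rewrite !meval_partial_span big_rcons /= eqxx mul0r addr0.
rewrite big_seq [RHS]big_seq; apply: eq_bigr => j jA.
by case: eqP => // jl; rewrite jl (negbTE lA) in jA.
Qed.

Lemma partial_sphere_irreducible A : irreducible_closed (partial_sphere A).
Proof.
apply: (@sphere_image_irreducible _ _ _ _ hd _ _ _ _ (fun=> 0)) => p.
by rewrite meval_partial_span big1 // => l _; rewrite mul0r.
Qed.

Lemma partial_sphere_sub A : {subset A <= nb} -> partial_sphere A `<=` Y.
Proof.
move=> Anb; apply: zariski_closure_min; last exact: unit_cone_closed.
by apply: sphere_image_sub => // w; apply: span_set_orth.
Qed.

Lemma partial_sphere_base A : partial_sphere A (eps *: veronese d u).
Proof.
apply: sub_zariski_closure; exists (fun=> 0).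
have s1 i : stereo_den (fun _ : 'I_n => 0 : C) i = 1.
  by rewrite /stereo_den /gdot big1 ?addr0 // => p _; rewrite mul0r.
split=> [|i|].
- exists (fun=> 0) => //; apply/funext => p.
  by rewrite meval_partial_span big1 // => l _; rewrite mul0r.
- by rewrite s1 oner_neq0.
- congr (_ *: _); apply: eq_veronese => p.
  by rewrite /stereo_point /stereo_num s1 invr1; ring.
Qed.

Lemma partial_sphereS A l : l \notin A -> partial_sphere A `<=` partial_sphere (rcons A l).
Proof.
move=> lA; apply: zariski_closureS => y [w [Sw w0 ->]]; exists w.
by split=> //; apply: span_setS.
Qed.

Lemma chart_sphere w l : orthogonal_to u w -> (forall i, stereo_den w i != 0) ->
  dot (grp l) u (stereo_point u w) * (chart d u l).@[veronese d (stereo_point u w) 0] =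
  (\prod_(i < k) dot i u (stereo_point u w) ^+ d i) * (2 * (stereo_den w (grp l))^-1 * w l).
Proof.
move=> uw w0; rewrite chart_veronese //; congr (_ * _).
rewrite dot_stereo_point // /stereo_point /stereo_num.
by have := w0 (grp l) => h; field.
Qed.

(** A polynomial vanishing on the members of the chain that do not involve the free
    coordinate [l].  The factor [eval_at] vanishes at [veronese x] when some [u_i . x_i] does,
    in which case [chart_veronese] need not determine the value of [chart l]. *)
Definition separator l : {mpoly C[N]} := eval_at d u * chart d u l.

Lemma meval_separator l x : (separator l).@[(eps *: veronese d x) 0] =
  (\prod_(i < k) dot i u x ^+ d i) * (chart d u l).@[veronese d x 0].
Proof.
have -> : \prod_(i < k) dot i u x ^+ d i = (eval_at d u).@[veronese d x 0].
  rewrite meval_eval_at -pform_toV meval_pform.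
  by apply: eq_bigr => i _; rewrite dotC.
rewrite mevalM !mevalB !mevalZ !meval_partial_at !meval_eval_at toVZ mderivZ !mevalZ.
rewrite -[RHS]mul1r -eps2; ring.
Qed.

Lemma separator_partial_sphere A l : {subset A <= nb} -> l \in nb -> l \notin A ->
  vanishing_ideal (partial_sphere A) (separator l).
Proof.
move=> Anb lnb lA; have im0 : vanishing_ideal (image (span_set A)) (separator l).
  move=> _ [w [Sw w0 ->]]; rewrite meval_separator.
  have uw := span_set_orth Anb Sw.
  have := chart_sphere l uw w0; rewrite (span_set_out Anb lnb lA Sw) !mulr0.
  move=> /eqP; rewrite mulf_eq0 => /orP[/eqP d0|/eqP ->]; last by rewrite mulr0.
  by rewrite (bigD1 (grp l)) //= d0 expr0n (gtn_eqF (hd _)) !mul0r.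
by move=> y; apply.
Qed.

(** The [separator] does not vanish at the stereographic image of a multiple [s] of the
    [l]-th basis vector, provided that this image is defined and not orthogonal to [u] in
    any group. *)
Lemma partial_sphere_proper A l : {subset A <= nb} -> l \in nb -> l \notin A ->
  partial_sphere A `<` partial_sphere (rcons A l).
Proof.
move=> Anb lnb lA; split; first exact: partial_sphereS.
move=> sub; set kap := dot (grp l) (B l) (B l).
(* The conditions exclude [s = 0] and [s^4 kap^2 = 1]; the value 2 works when 1 does not. *)
have [s [s0 s1 s2]] : exists s : C, [/\ s != 0, 1 + s ^+ 2 * kap != 0 &
    1 - s ^+ 2 * kap != 0].
  have [k1|k1] := eqVneq (kap ^+ 2) 1.
    exists 2; split; first by rewrite pnatr_eq0.
      apply/eqP => E; have : (2 ^+ 2 * kap) ^+ 2 = 1 :> C.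
        by rewrite (_ : 2 ^+ 2 * kap = -1) ?sqrrN ?expr1n // -[LHS](addKr 1) E addr0.
      rewrite exprMn k1 mulr1 => /eqP; rewrite -!natrX pnatr_eq1.
      by [].
    apply/eqP => E; have : (2 ^+ 2 * kap) ^+ 2 = 1 :> C.
      by move/subr0_eq: E => <-; rewrite expr1n.
    rewrite exprMn k1 mulr1 => /eqP; rewrite -!natrX pnatr_eq1.
    by [].
  exists 1; rewrite expr1n mul1r oner_neq0; split=> //.
    by apply: contraNneq k1 => E; rewrite (_ : kap = -1) ?sqrrN ?expr1n // -[LHS](addKr 1) E addr0.
  by apply: contraNneq k1 => /subr0_eq <-; rewrite expr1n.
pose w p := s * B l p.
have uw : orthogonal_to u w.
  move=> i; transitivity (s * dot i u (B l)); last by rewrite orth_basis_orth ?mulr0.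
  by rewrite /gdot mulr_sumr; apply: eq_bigr => p _; rewrite mulrCA.
have Sw : span_set (rcons A l) w.
  exists (fun j => if j == l then s else 0) => //; apply/funext => p.
  rewrite meval_partial_span big_rcons /= eqxx big1_seq ?add0r // => j /= jA.
  by case: eqP => [jl|_]; [rewrite -jl jA in lA | rewrite mul0r].
have dw i : dot i w w = if i == grp l then s ^+ 2 * kap else 0.
  case: eqP => [->|/eqP il].
    by rewrite /kap /gdot mulr_sumr; apply: eq_bigr => p _; rewrite /w; ring.
  rewrite /gdot big1 // => p /eqP pi; rewrite /w /orth_basis.
  case: eqP => [pl|_]; first by rewrite -pi pl eqxx in il.
  case: eqP => [pl|_]; last by rewrite !mulr0.
  by rewrite -pi pl gb eqxx in il.
have w0 i : stereo_den w i != 0.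
  by rewrite /stereo_den dw; case: ifP => _ //; rewrite addr0 oner_neq0.
have wu i : dot i u (stereo_point u w) != 0.
  rewrite dot_stereo_point // mulf_neq0 ?invr_eq0 // /stereo_den dw.
  case: ifP => _; last by rewrite (_ : 2 - _ = 1) ?oner_neq0 //; ring.
  by rewrite (_ : 2 - _ = 1 - s ^+ 2 * kap) //; ring.
have T0 : \prod_(i < k) dot i u (stereo_point u w) ^+ d i != 0.
  by apply/prodf_neq0 => i _; rewrite expf_neq0.
have /sub yA : partial_sphere (rcons A l) (eps *: veronese d (stereo_point u w)).
  by apply: sub_zariski_closure; exists w.
have /eqP := separator_partial_sphere Anb lnb lA yA.
rewrite meval_separator mulf_eq0 (negbTE T0) /= => /eqP F0.
have /eqP := chart_sphere l uw w0; rewrite F0 mulr0 eq_sym.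
rewrite !mulf_eq0 (negbTE T0) invr_eq0 (negbTE (w0 _)) pnatr_eq0 /=.
by rewrite (negbTE s0) orth_basis_nonbase // eqxx oner_eq0.
Qed.

Lemma unit_cone_chain : irreducible_chain Y (eps *: veronese d u) (size nb).
Proof.
have tnb r : {subset take r nb <= nb} by move=> l; apply: mem_take.
exists (fun r => partial_sphere (take r nb)); split=> r rM.
  split; [exact: partial_sphere_irreducible|exact: partial_sphere_base|].
  exact: partial_sphere_sub.
have l0 : 'I_n by case: nb rM.
rewrite (take_nth l0 rM); apply: partial_sphere_proper => //.
  exact: mem_nth.
have := nonbase_uniq b; rewrite -{1}(cat_take_drop r.+1 nb) (take_nth l0 rM).
by rewrite cat_uniq rcons_uniq => /andP[/andP[]].
Qed.

End ChainThroughPoint.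

(** * An upper bound for the length of chains *)

Section Independence.
Variables (C : numClosedFieldType) (N : nat).
Implicit Types (P Q : {mpoly C[N]}) (Z : set 'rV[C]_N).

Lemma vanishing_ideal_prime Z P Q : irreducible_closed Z ->
  vanishing_ideal Z (P * Q) -> vanishing_ideal Z P \/ vanishing_ideal Z Q.
Proof.
case=> _ _ irr PQ.
have zl P' : zariski_closed (zero_locus [set P']) by exists [set P'].
have [y Zy|H|H] := irr _ _ (zl P) (zl Q).
- have /eqP := PQ y Zy; rewrite mevalM mulf_eq0 => /orP[] /eqP E.
    by left => _ ->.
  by right => _ ->.
- by left => y /H; apply.
- by right => y /H; apply.
Qed.

Lemma proper_separating Z0 Z1 : zariski_closed Z0 -> Z0 `<` Z1 ->
  exists P, vanishing_ideal Z0 P /\ ~ vanishing_ideal Z1 P.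
Proof.
move=> [E ->] [_ n10]; apply: contrapT => H; apply: n10 => y Z1y P EP.
suff PZ : vanishing_ideal Z1 P by apply: PZ.
by apply: contrapT => nP; apply: H; exists P; split=> // z; apply.
Qed.

Definition independent_on Z (T : finType) (Phi : T -> {mpoly C[N]}) :=
  forall c : T -> C, vanishing_ideal Z (\sum_t c t *: Phi t) -> forall t, c t = 0.

(** In a relation between the products [P^j * Phi t] on [Z1], restriction to [Z0], where [P]
    vanishes, kills the part with [j = 0] by independence there.  The rest is divisible by
    [P], which is not a zero divisor on the irreducible set [Z1]; divide and repeat. *)
Lemma independent_powers Z0 Z1 (T : finType) (Phi : T -> {mpoly C[N]}) P r :
  irreducible_closed Z1 -> Z0 `<=` Z1 ->
  vanishing_ideal Z0 P -> ~ vanishing_ideal Z1 P -> independent_on Z0 Phi ->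
  independent_on Z1 (fun bt : 'I_r * T => P ^+ bt.1 * Phi bt.2).
Proof.
move=> irr Z01 P0 P1 ind; elim: r => [|r IH] c; first by move=> _ [[]].
pose G j := \sum_t c (j, t) *: Phi t.
have E : \sum_bt c bt *: (P ^+ bt.1 * Phi bt.2) =
         G ord0 + P * \sum_(bt : 'I_r * T) c (lift ord0 bt.1, bt.2) *: (P ^+ bt.1 * Phi bt.2).
  transitivity (\sum_(j < r.+1) P ^+ j * G j).
    rewrite (eq_bigr (fun bt : 'I_r.+1 * T =>
      c (bt.1, bt.2) *: (P ^+ bt.1 * Phi bt.2))); last by case.
    rewrite -(pair_bigA _ (fun j t => c (j, t) *: (P ^+ j * Phi t))) /=.
    apply: eq_bigr => j _; rewrite mulr_sumr; apply: eq_bigr => t _.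
    by rewrite scalerAr.
  rewrite big_ord_recl expr0 mul1r; congr (_ + _).
  rewrite -(pair_bigA _ (fun j t => c (lift ord0 j, t) *: (P ^+ j * Phi t))) /=.
  rewrite mulr_sumr; apply: eq_bigr => j _.
  rewrite exprS -mulrA; congr (_ * _); rewrite mulr_sumr; apply: eq_bigr => t _.
  by rewrite scalerAr.
rewrite E => van.
have c0 t : c (ord0, t) = 0.
  apply: (ind (fun t => c (ord0, t))) => y Z0y.
  have := van y (Z01 _ Z0y).
  by rewrite mevalD mevalM (P0 _ Z0y) mul0r addr0.
have G0 : G ord0 = 0 by rewrite /G big1 // => t _; rewrite c0 scale0r.
move: van; rewrite G0 add0r => /(vanishing_ideal_prime irr) [/P1 //|van].
have c1 := IH (fun bt => c (lift ord0 bt.1, bt.2)) van.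
move=> [j t]; case: (unliftP ord0 j) => [j' ->|-> //].
exact: (c1 (j', t)).
Qed.

Definition degree_le K P := (msize P <= K.+1)%N.

Lemma degree_leM K L P Q : degree_le K P -> degree_le L Q -> degree_le (K + L) (P * Q).
Proof.
rewrite /degree_le => hP hQ.
have [->|P0] := eqVneq P 0; first by rewrite mul0r msize0.
have [->|Q0] := eqVneq Q 0; first by rewrite mulr0 msize0.
by have := leq_add hP hQ; rewrite addSn addnS msizeM //; case: (_ + _)%N.
Qed.

Lemma degree_leX K P r : degree_le K P -> degree_le (r * K) (P ^+ r).
Proof.
move=> hP; elim: r => [|r IH]; first by rewrite expr0 /degree_le msize1.
by rewrite exprS mulSn; apply: degree_leM.
Qed.

Lemma degree_le_trans K L P : (K <= L)%N -> degree_le K P -> degree_le L P.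
Proof. by rewrite /degree_le => KL /leq_trans; apply. Qed.

(** The functions are the monomials with exponents below [r] in polynomials separating the
    successive members; [e] is the sum of the degree bounds of these polynomials. *)
Lemma chain_independent (Z : nat -> set 'rV[C]_N) s :
  (forall i, (i <= s)%N -> irreducible_closed (Z i)) ->
  (forall i, (i < s)%N -> Z i `<` Z i.+1) ->
  exists e, forall r, exists (T : finType) (Phi : T -> {mpoly C[N]}),
    [/\ #|T| = (r ^ s)%N, independent_on (Z s) Phi & forall t, degree_le (r * e) (Phi t)].
Proof.
elim: s => [|s IH] irr inc.
  exists 0%N => r; exists unit, (fun=> 1); split=> [|c van []|t].
  - by rewrite card_unit expn0.
  - have [_ [y Zy] _] := irr 0%N isT.
    have := van y Zy; rewrite meval_sum (bigD1 tt) //= big1 ?addr0 => [|[] //].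
    by rewrite mevalZ meval1 mulr1.
  - by rewrite /degree_le msize1.
have [|j js|e he] := IH; [by move=> j /leqW /irr|exact/inc/ltnW|].
have [[closed_s _ _] prop_s] := (irr s (leqnSn s), inc s (ltnSn s)).
have [P [P0 P1]] := proper_separating closed_s prop_s.
exists (e + msize P)%N => r; have [T [Phi [cT ind deg]]] := he r.
exists ('I_r * T)%type, (fun bt : 'I_r * T => P ^+ bt.1 * Phi bt.2); split=> [||[j t] /=].
- by rewrite card_prod card_ord cT expnS.
- apply: independent_powers P0 P1 ind; first exact: irr.
  by case: prop_s.
- rewrite addnC mulnDr; apply: degree_leM; last exact: deg.
  apply: (@degree_le_trans (j * msize P)); last by apply: degree_leX; rewrite /degree_le.
  by rewrite leq_mul2r (ltnW (ltn_ord j)) orbT.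
Qed.

End Independence.

(** More vectors than the dimension of the space containing them are dependent. *)
Lemma rank_bound (K : fieldType) (T R : finType) (A : T -> R -> K) :
  (forall c : T -> K, (forall r, \sum_t c t * A t r = 0) -> forall t, c t = 0) ->
  (#|T| <= #|R|)%N.
Proof.
move=> inj; rewrite -(_ : \rank (\matrix_(i < #|T|, j < #|R|) A (enum_val i) (enum_val j)) = #|T|).
  exact: rank_leq_col.
apply/eqP/inj_row_free => v vA; apply/rowP => i; rewrite mxE.
rewrite -(enum_valK i); apply: (inj (fun t => v 0 (enum_rank t))) => r.
have /rowP /(_ (enum_rank r)) := vA; rewrite !mxE => E; rewrite -[RHS]E.
rewrite (reindex (@enum_val T T)) /=; last first.
  by exists enum_rank => x _; rewrite ?enum_valK ?enum_rankK.
by apply: eq_bigr => j _; rewrite mxE enum_valK enum_rankK.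
Qed.

Section DimensionBound.
Variables (C : numClosedFieldType) (k : nat) (m d : 'I_k -> nat).
Hypothesis hd : forall i, (0 < d i)%N.
Local Notation n := (nvars m).
Local Notation N := (dimV m d).
Local Notation Y := (@unit_cone C k m d).
Local Notation dot := (@gdot C n k (@grp k m)).
Local Notation D := (\sum_(i < k) d i)%N.
Variable b : 'I_k -> 'I_n.
Hypothesis gb : forall i, grp (b i) = i.
Implicit Types (a : 'X_{1..n}) (x : 'I_n -> C).
Local Notation nb := (nonbase b).

(** Exponents of the reduced monomials: parity for the sign [eps], 0 or 1 for each
    eliminated variable [x (b i)], and at most [K] for the others. *)
Definition reduced K : finType :=
  (bool * {ffun 'I_k -> bool} * {ffun 'I_(size nb) -> 'I_K.+1})%type.

Lemma card_reduced K : #|{: reduced K}| = (2 * 2 ^ k * K.+1 ^ size nb)%N.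
Proof. by rewrite !card_prod !card_ffun card_bool !card_ord. Qed.

Definition reduced_value K (r : reduced K) (eps : C) x : C :=
  eps ^+ r.1.1 * (\prod_(i < k) x (b i) ^+ r.1.2 i) *
  \prod_(j < size nb) x (tnth (in_tuple nb) j) ^+ r.2 j.

(** Functions of [eps] and [x] that agree, where [eps^2 = 1] and [x] lies on the product of
    spheres, with a combination of reduced monomials. *)
Definition reducible K (F : C -> ('I_n -> C) -> C) := exists c : reduced K -> C,
  forall eps x, eps ^+ 2 = 1 -> unit_vector x ->
    F eps x = \sum_r c r * reduced_value r eps x.

Lemma reducible_add K F G : reducible K F -> reducible K G ->
  reducible K (fun eps x => F eps x + G eps x).
Proof.
move=> [c cE] [c' c'E]; exists (fun r => c r + c' r) => eps x e2 xu.
by rewrite cE // c'E // -big_split; apply: eq_bigr => r _; rewrite mulrDl.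
Qed.

Lemma reducible_scale K c0 F : reducible K F ->
  reducible K (fun eps x => c0 * F eps x).
Proof.
move=> [c cE]; exists (fun r => c0 * c r) => eps x e2 xu.
by rewrite cE // mulr_sumr; apply: eq_bigr => r _; rewrite mulrA.
Qed.

Lemma reducible_sum K (I : Type) (s : seq I) (p : pred I) F :
  (forall i, p i -> reducible K (F i)) ->
  reducible K (fun eps x => \sum_(i <- s | p i) F i eps x).
Proof.
move=> H; elim: s => [|i s IH].
  exists (fun=> 0) => eps x _ _.
  by rewrite big_nil big1 // => r _; rewrite mul0r.
case pi: (p i); last first.
  have [c cE] := IH; exists c => eps x e2 xu.
  by rewrite big_cons pi cE.
have [c cE] := reducible_add (H i pi) IH; exists c => eps x e2 xu.
by rewrite big_cons pi cE.
Qed.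

Lemma eq_reducible K F G :
  (forall eps x, eps ^+ 2 = 1 -> unit_vector x -> F eps x = G eps x) ->
  reducible K F -> reducible K G.
Proof. by move=> FG [c cE]; exists c => eps x e2 xu; rewrite -FG // cE. Qed.

Definition mono a x : C := \prod_(l < n) x l ^+ a l.

Lemma monoD a a' x : mono (a + a')%MM x = mono a x * mono a' x.
Proof.
rewrite /mono -big_split; apply: eq_bigr => l _ /=.
by rewrite mnmDE exprD.
Qed.

Lemma mono2U l x : mono (U_(l) *+ 2)%MM x = x l ^+ 2.
Proof.
rewrite /mono (bigD1 l) //= big1 ?mulr1 => [|j jl].
  by rewrite mulmnE mnm1E eqxx.
by rewrite mulmnE mnm1E eq_sym (negbTE jl).
Qed.

Lemma big_base (F : 'I_n -> C) :
  \prod_(l < n) F l = (\prod_(i < k) F (b i)) * \prod_(j < size nb) F (tnth (in_tuple nb) j).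
Proof.
rewrite -(big_tuple _ _ (in_tuple nb) xpredT F) /= big_filter big_enum_cond /=.
rewrite (bigID (fun l => l == b (grp l))) /=; congr (_ * _).
rewrite (reindex_onto b (@grp k m)) /= => [|l /eqP //].
by apply: eq_bigl => i; rewrite gb !eqxx.
Qed.

Lemma mono_reduced K s a : (mdeg a <= K)%N -> (forall i, a (b i) <= 1)%N ->
  reducible K (fun eps x => eps ^+ s * mono a x).
Proof.
move=> aK a1; have aleK l : (a l < K.+1)%N.
  rewrite ltnS (leq_trans _ aK) // mdegE (bigD1 l) //=.
  by rewrite leq_addr.
pose r : reduced K := (odd s, [ffun i => a (b i) == 1%N],
   [ffun j => inord (a (tnth (in_tuple nb) j))]).
exists (fun r' => (r' == r)%:R) => eps x e2 _.
rewrite (bigD1 r) //= eqxx mul1r big1 ?addr0 => [|r' /negbTE ->]; last by rewrite mul0r.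
rewrite /reduced_value /mono big_base -mulrA /=; congr (_ * (_ * _)).
- by rewrite -[in LHS](odd_double_half s) -muln2 mulnC exprD exprM e2 expr1n mulr1.
- apply: eq_bigr => i _; rewrite ffunE; congr (_ ^+ _).
  by have := a1 i; case: (a (b i)) => [|[|]].
- by apply: eq_bigr => j _; rewrite ffunE inordK.
Qed.

(** On the spheres, [x (b i) ^+ 2] can be replaced by 1 minus the other squares of the
    group.  This does not raise the total degree and lowers the total exponent of the
    variables [x (b i)], on which the induction is. *)
Lemma mono_reducible K s a : (mdeg a <= K)%N ->
  reducible K (fun eps x => eps ^+ s * mono a x).
Proof.
have [M] := ubnP (\sum_(i < k) a (b i))%N.
elim: M a => // M IH a aM aK.
have [a1|] := pselect (forall i, a (b i) <= 1)%N; first exact: mono_reduced.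
move=> /existsNP [i /negP]; rewrite -ltnNge => a2.
pose a' := (a - U_(b i) *+ 2)%MM.
have aE : a = (a' + U_(b i) *+ 2)%MM.
  rewrite submK //; apply/mnm_lepP => l; rewrite mulmnE mnm1E.
  by case: eqP => [<-|_]; rewrite ?mul1n ?mul0n.
have dE : mdeg a = (mdeg a' + 2)%N by rewrite aE mdegD mdegMn mdeg1 mul1n.
have sE : (\sum_(j < k) a (b j) = \sum_(j < k) a' (b j) + 2)%N.
  rewrite (bigD1 i) //= [in RHS](bigD1 i) //= addnAC; congr (_ + _)%N.
    by rewrite aE mnmDE mulmnE mnm1E eqxx.
  apply: eq_bigr => j ji; rewrite aE mnmDE mulmnE mnm1E.
  case: eqP => [bij|_]; last by rewrite addn0.
  by move: ji; rewrite -(gb j) -bij gb eqxx.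
have s' : (\sum_(j < k) a' (b j) < M)%N by move: aM; rewrite sE; lia.
have H1 : reducible K (fun eps x => eps ^+ s * mono a' x).
  by apply: IH => //; move: aK; rewrite dE; lia.
have H2 l : (grp l == i) && (l != b i) ->
    reducible K (fun eps x => (-1) * (eps ^+ s * mono (a' + U_(l) *+ 2)%MM x)).
  move=> /andP[li lb]; apply: reducible_scale; apply: IH.
    rewrite (eq_bigr (fun j => a' (b j))) // => j _.
    rewrite mnmDE mulmnE mnm1E; case: eqP => [lE|_]; last by rewrite addn0.
    by move: lb li; rewrite lE gb => /[swap] /eqP ->; rewrite eqxx.
  by rewrite mdegD mdegMn mdeg1 mul1n -dE.
apply: eq_reducible (reducible_add H1 (reducible_sum (index_enum _) H2)) => eps x _ xu.
have xi : x (b i) ^+ 2 = 1 - \sum_(l | (grp l == i) && (l != b i)) x l ^+ 2.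
  rewrite -(xu i) /gdot (bigD1 (b i)) /= ?gb // -expr2.
  under [X in _ = _ + X - _]eq_bigr do rewrite -expr2.
  by rewrite addrK.
rewrite aE monoD mono2U xi mulrBr mulr1 mulrBr; congr (_ + _).
rewrite !mulr_sumr -sumrN; apply: eq_bigr => l _.
by rewrite monoD mono2U; ring.
Qed.

(** Pullback along [veronese] multiplies degrees by the sum of the [d i]. *)
Lemma degree_le_reducible K (P : {mpoly C[N]}) : degree_le K P ->
  reducible (D * K) (fun eps x => P.@[(eps *: veronese d x) 0]).
Proof.
rewrite /degree_le => PK.
apply: (@eq_reducible _ (fun eps x =>
   \sum_(a <- msupp P | a \in msupp P) P@_a * (\prod_l bw_scale C l ^+ a l) *
   (eps ^+ mdeg a * mono [multinom (\sum_l exponent l j * a l)%N | j < n] x))).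
  move=> eps x _ _; rewrite mevalE [RHS]big_seq; apply: eq_bigr => a _.
  rewrite -!mulrA; congr (_ * _); rewrite mulrCA -veronese_monomial mdegE -prodrXr -big_split.
  by apply: eq_bigr => l _; rewrite [in RHS]mxE exprMn.
apply: reducible_sum => a aP; apply/reducible_scale/mono_reducible.
have aK : (mdeg a <= K)%N by rewrite -ltnS (leq_trans _ PK) // msize_mdeg_lt.
rewrite (leq_trans _ (leq_mul (leqnn D) aK)) // mdegE.
under eq_bigr do rewrite mnmE.
rewrite exchange_big /= [X in (_ <= _ * X)%N]mdegE big_distrr /=.
by apply: leq_sum => l _; rewrite -big_distrl /= -mdegE mdeg_exponent.
Qed.

Lemma independent_bound (T : finType) (Phi : T -> {mpoly C[N]}) K :
  independent_on Y Phi -> (forall t, degree_le K (Phi t)) ->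
  (#|T| <= 2 * 2 ^ k * (D * K).+1 ^ size nb)%N.
Proof.
move=> ind deg; rewrite -card_reduced.
have /choice [A AE] : forall t, exists c : reduced (D * K) -> C,
    forall eps x, eps ^+ 2 = 1 -> unit_vector x ->
      (Phi t).@[(eps *: veronese d x) 0] = \sum_r c r * reduced_value r eps x.
  by move=> t; apply: degree_le_reducible.
apply: (@rank_bound C _ _ A) => c cA; apply: ind => _ /(unit_coneP hd) [eps [x [e2 xu ->]]].
rewrite meval_sum.
under eq_bigr do rewrite mevalZ AE // mulr_sumr.
rewrite exchange_big /= big1 // => r _.
by under eq_bigr do rewrite mulrA; rewrite -mulr_suml cA mul0r.
Qed.

(** There are [r ^ s] independent functions of degree at most [r * e] and at most a constant
    times [r ^ M] reduced monomials for this degree; if [s > M] then dividing by [r ^ M]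
    bounds [r]. *)
Lemma unit_cone_chain_bound y s : irreducible_chain Y y s -> (s <= size nb)%N.
Proof.
case=> Z [Zi Zinc]; rewrite leqNgt; apply/negP => sM.
have [|//|e he] := @chain_independent C N Z s; first by move=> j /Zi [].
set M := size nb in sM.
have bound r : (0 < r)%N -> (r <= 2 * 2 ^ k * (D * e).+1 ^ M)%N.
  move=> r0; have [T [Phi [cT ind deg]]] := he r.
  have indY : independent_on Y Phi.
    move=> c van; apply: ind => z Zz; apply: van.
    by have [_ _] := Zi s (leqnn s); apply.
  have := independent_bound indY deg; rewrite cT -/M => h.
  have h1 : (r ^ M.+1 <= r ^ s)%N by rewrite leq_pexp2l.
  have h2 : ((D * (r * e)).+1 ^ M <= ((D * e).+1 * r) ^ M)%N.
    by case: (M) => [//|M']; rewrite leq_exp2r //; nia.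
  rewrite -(leq_pmul2r (_ : 0 < r ^ M)%N) ?expn_gt0 ?r0 // -expnS.
  apply: leq_trans h1 (leq_trans h _).
  by rewrite -[leqRHS]mulnA -expnMn leq_mul2l h2 orbT.
by have := bound (2 * 2 ^ k * (D * e).+1 ^ M).+1%N isT; rewrite ltnn.
Qed.

End DimensionBound.

(** * Eigenvectors and singular tuples *)

Section Eigenvectors.
Variables (C : numClosedFieldType) (k : nat) (m d : 'I_k -> nat).
Hypothesis hd : forall i, (0 < d i)%N.
Local Notation n := (nvars m).
Local Notation N := (dimV m d).
Local Notation Y := (@unit_cone C k m d).
Local Notation dot := (@gdot C n k (@grp k m)).
Implicit Types (u z : 'I_n -> C).

Lemma unit_cone_nonsingular eps u : eps ^+ 2 = 1 -> unit_vector u ->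
  nonsingular Y (eps *: veronese d u).
Proof.
move=> e2 uu; split; first by apply/(unit_coneP hd); exists eps, u.
have /choice [b bE] : forall i, exists l, grp l = i /\ u l != 0.
  move=> i; apply: contrapT => H; have /eqP := uu i.
  rewrite /gdot big1 => [|l /eqP li]; first by rewrite eq_sym oner_eq0.
  have [->|ul] := eqVneq (u l) 0; first by rewrite mulr0.
  by case: H; exists l.
have gb i : grp (b i) = i by have [] := bE i.
have ub i : u (b i) != 0 by have [] := bE i.
exists (size (nonbase b)); split; last exact: unit_cone_tangent_dim.
split; first exact: unit_cone_chain.
by move=> s; apply: unit_cone_chain_bound.
Qed.

Variable omega : nat.
Hypothesis homega : (0 < omega)%N.
Variable f : {mpoly C[N]}.
Hypothesis hf : f \is omega.-homog.
Local Notation g := (proj omega f).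
Local Notation e := (fun i => omega * d i)%N.

(** The chain rule for [g(u) = f(veronese u)], with the sign [eps] moved out of the argument
    of [f] by homogeneity. *)
Lemma differential_proj eps u z : eps ^+ 2 = 1 ->
  eps * differential f (eps *: veronese d u) (dveronese d u z) =
  eps ^+ omega * \sum_p g^`M(p).@[u] * z p.
Proof.
move=> e2.
have E : f \mPo [tuple eps *: bw_basis C l | l < N] = eps ^+ omega *: g.
  apply: mpoly_eval_inj => x; rewrite mevalZ (proj_meval hd homega hf).
  rewrite -(homog_meval _ _ hf) comp_mpoly_meval; apply: meval_eq => l.
  by rewrite tnth_mktuple mevalZ mxE.
have ptE : (fun l => (tnth [tuple eps *: bw_basis C l | l < N] l).@[u]) =
    (eps *: veronese d u) 0.
  by apply/funext => l; rewrite tnth_mktuple mevalZ !mxE.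
transitivity (\sum_p (eps ^+ omega *: g)^`M(p).@[u] * z p); last first.
  by rewrite mulr_sumr; apply: eq_bigr => p _; rewrite mderivZ mevalZ mulrA.
under [RHS]eq_bigr => p _.
  rewrite -E mderiv_comp meval_sum mulr_suml.
  under eq_bigr => l _ do
    rewrite mevalM comp_mpoly_meval ptE tnth_mktuple mderivZ mevalZ.
over.
rewrite exchange_big differentialE mulr_sumr /=; apply: eq_bigr => l _.
rewrite [X in _ * (_ * X)]mxE !mulr_sumr; apply: eq_bigr => p _.
by ring.
Qed.

Lemma euler_proj u i :
  \sum_(p | grp p == i) u p * g^`M(p).@[u] = (e i)%:R * g.@[u].
Proof. by have [z ->] := proj_toV hd homega hf; rewrite euler_toV. Qed.

(** Testing on the projection [z] of the [q]-th unit vector to the orthogonal complement of [u]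
    gives the [q]-th component of the equation, and Euler's identity evaluates the
    coefficient of [u q]. *)
Lemma critical_gradient u : unit_vector u ->
  (forall z, orthogonal_to u z -> \sum_p g^`M(p).@[u] * z p = 0) <->
  exists sigma, forall q, g^`M(q).@[u] = (e (grp q))%:R * sigma * u q.
Proof.
move=> uu; split=> [crit|[sigma E] z uz]; last first.
  rewrite (partition_big (@grp k m) xpredT) //= big1 // => i _.
  transitivity ((e i)%:R * sigma * dot i u z); last by rewrite uz mulr0.
  by rewrite mulr_sumr; apply: eq_bigr => p /eqP <-; rewrite E; ring.
exists g.@[u] => q.
pose z p : C := (p == q)%:R - u q * ((grp p == grp q)%:R * u p).
have sumz (F : 'I_n -> C) : \sum_p F p * z p =
    F q - u q * \sum_(p | grp p == grp q) u p * F p.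
  under eq_bigr do rewrite mulrBr.
  rewrite sumrB; congr (_ - _).
    rewrite (bigD1 q) //= eqxx mulr1 big1 ?addr0 // => p /negbTE ->.
    by rewrite mulr0.
  rewrite mulr_sumr [RHS]big_mkcond /=; apply: eq_bigr => p _.
  by case: ifP => _; rewrite ?mul1r ?mul0r ?mulr0 //; ring.
have uz : orthogonal_to u z.
  move=> i; transitivity (\sum_p ((grp p == i)%:R * u p) * z p).
    rewrite /gdot big_mkcond /=; apply: eq_bigr => p _.
    by case: ifP => _; rewrite ?mul1r // !mul0r.
  rewrite sumz; have [->|qi] := eqVneq (grp q) i.
    rewrite (eq_bigr (fun p => u p * u p)) => [|p ->]; last by rewrite mul1r.
    by have := uu i; rewrite /gdot => ->; rewrite mulr1 mul1r subrr.
  rewrite mul0r big1 ?mulr0 ?subr0 // => p /eqP ->.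
  by rewrite (negbTE qi) mul0r mulr0.
have := crit z uz; rewrite sumz euler_proj => /subr0_eq ->.
by ring.
Qed.

Lemma vnum_tagged (l : 'I_n) : vnum (tagged (enum_val l)) = l.
Proof. by rewrite /vnum -[RHS]enum_valK; case: (enum_val l). Qed.

Lemma singular_tupleE (v : vectors C m) : singular_tuple e g v <->
  unit_vector (coords v) /\
  exists sigma, forall q, g^`M(q).@[coords v] = (e (grp q))%:R * sigma * coords v q.
Proof.
have e0 i : (e i)%:R != 0 :> C by rewrite pnatr_eq0 -lt0n muln_gt0 homega hd.
split=> [[uv [sigma E]]|[uv [sigma E]]]; split.
- move=> i; rewrite -(uv i) /gdot -(big_vnum _ _ (fun l => coords v l * coords v l)).
  by apply: eq_bigr => j _; rewrite coords_vnum.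
- exists sigma => q; have /rowP /(_ (tagged (enum_val q))) := E (grp q).
  rewrite !mxE vnum_tagged => H.
  by rewrite -mulrA /coords -/(grp q) -H mulrA mulfV ?mul1r.
- move=> i; rewrite -(uv i) /gdot -(big_vnum _ _ (fun l => coords v l * coords v l)).
  by apply: eq_bigr => j _; rewrite coords_vnum.
- exists sigma => i; apply/rowP => j; rewrite !mxE E grp_vnum coords_vnum.
  by rewrite !mulrA mulVf ?mul1r.
Qed.

Lemma eigenvector_singular_tuple psi :
  eigenvector f psi <->
  exists v : vectors C m, singular_tuple e g v /\
    (psi = tensor_pow d v \/ psi = - tensor_pow d v).
Proof.
split=> [[y [-> [Yy _] crit]]|[v [/singular_tupleE [uv sv] psiE]]].
  have [eps [u [e2 uu yE]]] := (unit_coneP hd y).1 Yy.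
  exists (unflat u); split; last first.
    rewrite tensor_pow_unflat yE toVZ -pform_toV.
    by have /eqP := e2; rewrite sqrf_eq1 => /orP[] /eqP ->;
       [left; rewrite scale1r | right; rewrite scaleN1r].
  have cu : coords (unflat u) = u by apply/funext/coords_unflat.
  apply/singular_tupleE; rewrite cu; split=> //; apply/critical_gradient => // z uz.
  have /eqP := differential_proj u z e2.
  rewrite -yE crit ?mulr0; last by rewrite yE; apply: tangent_sup.
  rewrite eq_sym mulf_eq0 expf_eq0 => /orP[/andP[_ /eqP e0]|/eqP //].
  by move: e2 => /eqP; rewrite e0 expr0n eq_sym oner_eq0.
have [eps [e2 {}psiE]] : exists eps : C, eps ^+ 2 = 1 /\ psi = eps *: tensor_pow d v.
  case: psiE => ->; first by exists 1; rewrite expr1n scale1r.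
  by exists (-1); rewrite sqrrN expr1n scaleN1r.
exists (eps *: veronese d (coords v)); split.
- by rewrite toVZ -pform_toV -tensor_powE.
- exact: unit_cone_nonsingular.
move=> w /(tangent_sub hd e2 uv) [z [uz ->]].
have /eqP := differential_proj (coords v) z e2.
rewrite ((critical_gradient uv).2 sv) // mulr0 mulf_eq0 => /orP[/eqP e0|/eqP //].
by move: e2 => /eqP; rewrite e0 expr0n eq_sym oner_eq0.
Qed.

End Eigenvectors.

Theorem proposition5p5 (R : realType) (k : nat) (m d : 'I_k -> nat)
    (hm : forall i, (0 < m i)%N) (hd : forall i, (0 < d i)%N)
    (omega : nat) (homega : (1 <= omega)%N)
    (f : {mpoly R[i][dimV m d]}) (hf : f \is omega.-homog)
    (psi : {mpoly R[i][nvars m]}) (hpsi : multihomog d psi) :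
  eigenvector f psi <->
  exists v : vectors R[i] m,
    singular_tuple (fun i => omega * d i)%N (proj omega f) v /\
    (psi = tensor_pow d v \/ psi = - tensor_pow d v).
Proof. exact: eigenvector_singular_tuple. Qed.
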